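(* Let $\Sigma$ be a surface of constant curvature (Euclidean plane, unit sphere or hyperbolic plane). Then each conic on $\Sigma$ has string Poritsky property: every germ of regular curve with non-zero geodesic curvature that is contained in a conic of $\Sigma$ has string Poritsky property.
   Context: Models: consider $\mathbb R^3$ with coordinates $(x_1,x_2,x_3)$, $\langle x,x\rangle=x_1^2+x_2^2+x_3^2$. The surfaces of constant curvature are: the Euclidean plane $\Sigma=\{x_3=1\}$, $Q=\operatorname{diag}(1,1,0)$; the unit sphere $\Sigma=\{x_1^2+x_2^2+x_3^2=1\}$, $Q=\mathrm{Id}$; the hyperbolic plane $\Sigma=\{x_1^2+x_2^2-x_3^2=-1\}\cap\{x_3>0\}$, $Q=\operatorname{diag}(1,1,-1)$. The metric on $\Sigma$ is induced by the quadratic form $\langle Qx,x\rangle$. Geodesics are intersections of $\Sigma$ with two-dimensional vector subspaces of $\mathbb R^3$. Conics on $\Sigma$ are intersections of $\Sigma$ with quadrics $\{\langle Cx,x\rangle=0\}$, where $C$ is a (non-zero) real symmetric $3\times3$ matrix. String Poritsky property: let $\gamma$ be a germ of oriented curve with non-zero geodesic curvature on a Riemannian surface. For $A,B\in\gamma$ close enough let $C_{AB}$ be the unique nearby intersection point of the geodesics tangent to $\gamma$ at $A$ and at $B$, $\lambda(A,B)$ the length of the arc $AB$ of $\gamma$, and $L(A,B)=|AC_{AB}|+|BC_{AB}|-\lambda(A,B)$, where $|XY|$ is the length of the small geodesic segment $XY$. The germ $\gamma$ has string Poritsky property if it admits a $C^1$-smooth parametrization by a parameter $t$ (a $C^1$-smooth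 local coordinate on $\gamma$) such that for every $p>0$ small enough there exists $c_p>0$ such that for every pair $B,A\in\gamma$ ordered by orientation with $L(A,B)=p$ one has $t(A)-t(B)=c_p$. *)

(* Defs.v *)
From Stdlib Require Import Reals.
From Coquelicot Require Import Coquelicot.
Open Scope R_scope.

Definition vec3 : Type := (R * R * R)%type.
Definition x1 (x : vec3) : R := fst (fst x).
Definition x2 (x : vec3) : R := snd (fst x).
Definition x3 (x : vec3) : R := snd x.

Definition dot (x y : vec3) : R := x1 x * x1 y + x2 x * x2 y + x3 x * x3 y.

(* Matrix entries are indexed from 0. *)
Definition apply_mx (M : @matrix R 3 3) (x : vec3) : vec3 :=
  let row i := coeff_mat 0 M i 0 * x1 x + coeff_mat 0 M i 1 * x2 x
             + coeff_mat 0 M i 2 * x3 x in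
  (row 0%nat, row 1%nat, row 2%nat).

Definition symmetric_mx (M : @matrix R 3 3) : Prop :=
  forall i j : nat, (i < 3)%nat -> (j < 3)%nat ->
    coeff_mat 0 M i j = coeff_mat 0 M j i.

Definition diag3 (d : vec3) : @matrix R 3 3 :=
  mk_matrix 3 3 (fun i j =>
    match i, j with
    | 0%nat, 0%nat => x1 d
    | 1%nat, 1%nat => x2 d
    | 2%nat, 2%nat => x3 d
    | _, _ => 0
    end).

Inductive geometry : Set := Euclidean | Spherical | Hyperbolic.

Definition on_surface (g : geometry) (x : vec3) : Prop :=
  match g with
  | Euclidean => x3 x = 1
  | Spherical => x1 x ^ 2 + x2 x ^ 2 + x3 x ^ 2 = 1
  | Hyperbolic => x1 x ^ 2 + x2 x ^ 2 - x3 x ^ 2 = -1 /\ x3 x > 0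
  end.

Definition Qmx (g : geometry) : @matrix R 3 3 :=
  match g with
  | Euclidean => diag3 (1, 1, 0)
  | Spherical => diag3 (1, 1, 1)
  | Hyperbolic => diag3 (1, 1, -1)
  end.

Definition metric (g : geometry) (u v : vec3) : R := dot (apply_mx (Qmx g) u) v.

Definition norm_Q (g : geometry) (u : vec3) : R := sqrt (metric g u u).

Definition Gauss_curvature (g : geometry) : R :=
  match g with Euclidean => 0 | Spherical => 1 | Hyperbolic => -1 end.

Definition on_conic (g : geometry) (C : @matrix R 3 3) (x : vec3) : Prop :=
  on_surface g x /\ dot (apply_mx C x) x = 0.

Definition D (c : R -> vec3) (s : R) : vec3 :=
  (Derive (fun u => x1 (c u)) s,
   Derive (fun u => x2 (c u)) s,
   Derive (fun u => x3 (c u)) s).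

(* A germ of curve is represented by a total function [c : R -> vec3] and a
   base parameter [s0]; only the values of [c] near [s0] matter, and the
   orientation is that of increasing parameter. *)
Definition C2_germ (c : R -> vec3) (s0 : R) : Prop :=
  locally s0 (fun s =>
    ex_derive c s /\ ex_derive (D c) s /\ continuous (D (D c)) s).

Definition regular_germ (g : geometry) (c : R -> vec3) (s0 : R) : Prop :=
  C2_germ c s0 /\
  locally s0 (fun s => on_surface g (c s) /\ D c s <> zero).

(* The Levi-Civita derivative of the velocity of a curve in the surface is the
   component of c'' tangent to the surface.  In the curved cases the
   Q-orthogonal complement of the tangent plane at x is spanned by x, and
   <Qx,x> = K = 1/K; in the Euclidean case c'' is already tangent. *)
Definition covariant_acceleration (g : geometry) (c : R -> vec3) (s : R) : vec3 :=
  minus (D (D c) s)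
        (scal (Gauss_curvature g * metric g (D (D c) s) (c s)) (c s)).

(* Unsigned geodesic curvature, for an arbitrary regular parametrization. *)
Definition geodesic_curvature (g : geometry) (c : R -> vec3) (s : R) : R :=
  let v := D c s in
  let a := covariant_acceleration g c s in
  norm_Q g (minus a (scal (metric g a v / metric g v v) v)) / metric g v v.

Definition arc_length (g : geometry) (c : R -> vec3) (a b : R) : R :=
  RInt (fun s => norm_Q g (D c s)) a b.

(* Radial projection to the surface. *)
Definition radial_proj (g : geometry) (x : vec3) : vec3 :=
  match g with
  | Euclidean => scal (/ x3 x) x
  | Spherical => scal (/ sqrt (metric g x x)) x
  | Hyperbolic => scal (/ sqrt (- metric g x x)) x
  end.

(* The small geodesic segment XY, for [s] in [0,1]: the radial projection of the
   chord of R^3 joining X to Y.  On the sphere this is the minor arc of great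
   circle, and X, Y must not be antipodal. *)
Definition geodesic_segment (g : geometry) (X Y : vec3) (s : R) : vec3 :=
  radial_proj g (plus (scal (1 - s) X) (scal s Y)).

Definition segment_length (g : geometry) (X Y : vec3) : R :=
  arc_length g (geodesic_segment g X Y) 0 1.

(* The intersection of the surface with the plane spanned by c(s) and c'(s). *)
Definition tangent_geodesic (g : geometry) (c : R -> vec3) (s : R) (X : vec3) : Prop :=
  on_surface g X /\
  exists alpha beta : R, X = plus (scal alpha (c s)) (scal beta (D c s)).

(* [X] is an intersection point, near [O], of the geodesics tangent to [c] at
   c(a) and c(b); [ball] is the sup-norm ball of R^3. *)
Definition tangent_intersection (g : geometry) (c : R -> vec3) (O : vec3) (r : R)
    (a b : R) (X : vec3) : Prop :=
  ball O r X /\ tangent_geodesic g c a X /\ tangent_geodesic g c b X.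

(* |AC| + |BC| - lambda(A,B) for A = c(a), B = c(b), with b before a and [X] in
   the role of the point C_AB. *)
Definition string_L (g : geometry) (c : R -> vec3) (a b : R) (X : vec3) : R :=
  segment_length g (c a) X + segment_length g (c b) X - arc_length g c b a.

(* [r] fixes what "nearby" intersection point means and [delta] fixes a
   representative of the germ; the existence and uniqueness clause states that
   C_AB is well defined on this representative.  The local coordinate [t] is
   expressed in terms of the parameter of [c]. *)
Definition string_Poritsky (g : geometry) (c : R -> vec3) (s0 : R) : Prop :=
  exists r delta : posreal,
    let near s := s0 - delta < s < s0 + delta in
    let C_AB := tangent_intersection g c (c s0) r in
    (forall a b, near a -> near b -> b < a -> exists! X, C_AB a b X) /\
    exists t : R -> R,
      (forall s, near s ->
         ex_derive t s /\ continuous (Derive t) s /\ Derive t s <> 0) /\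
      exists p0 : posreal, forall p, 0 < p < p0 ->
        exists c_p, 0 < c_p /\
          forall a b X, near a -> near b -> b < a -> C_AB a b X ->
            string_L g c a b X = p -> t a - t b = c_p.

(* Main.v *)
(* Let X be the point where the geodesics tangent at A = c(a) and B = c(b) meet,
   and let theta be the angle between them at X.  The first variation formula is
     dL = (1 - cos theta) / sin theta * (S_A k_A ds_A - S_B k_B ds_B),
   where k is the geodesic curvature, s the arc length and S_A the length |AX|,
   its sine or its hyperbolic sine according to the geometry.  If the curve lies
   on the conic <Cx,x> = 0, then, v being the unit velocity, evaluating <CX,X>
   from A and from B gives S_A^2 <C v_A, v_A> = S_B^2 <C v_B, v_B>.  So with
   dt = k |<Cv,v>|^(-1/2) ds the variation dL is a positive multiple of
   dt_A - dt_B, and L is an increasing function of t(A) - t(B) alone.  The form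
   <Cv,v> does not vanish: otherwise the curve would pass through the vertex of
   a degenerate cone, which for k <> 0 forces C = 0. *)

(* Distances enter through their tangents (hyperbolic tangents if K = -1, lengths if K = 0). The
   planes of two tangent geodesics meet in a line, so the tangent of the distance from a point of
   the curve to the meeting point is a speed times a quotient of determinants, and one computation
   with a parameter K serves the three geometries. The curve is only C^2: its curvature is merely
   continuous, t is only C^1, and L is differentiated once. So L is recovered from the first
   variation alone: a pair slides along a curve t(A) - t(B) = const, which is differentiable because
   t has a differentiable inverse, and then A moves with B fixed. This is why the variation is
   computed along arbitrary paths of pairs. On the diagonal A = B the quotient of determinants is
   0/0. It is never approached: a convexity condition in two parameters bounds the quotient off the
   diagonal, and only pairs with B strictly before A are compared. Nor is L shown to take the value
   p: if some pair has L = p, that pair provides c_p. *)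
From Stdlib Require Import Reals Lra Nsatz Ranalysis5 Classical.
From Coquelicot Require Import Coquelicot.
Require Import Defs.
Open Scope R_scope.

(** * Linear algebra of orthonormal frames *)

(* With P = diag(K, K, 1) the surface lies in <Px,x> = 1 in all three geometries,
   and <Px,v> = 0 is its tangent plane at x. *)
Definition surface_form (g : geometry) (x y : vec3) : R :=
  Gauss_curvature g * (x1 x * x1 y + x2 x * x2 y) + x3 x * x3 y.

Definition cross (x y : vec3) : vec3 :=
  (x2 x * x3 y - x3 x * x2 y, x3 x * x1 y - x1 x * x3 y, x1 x * x2 y - x2 x * x1 y).

Definition det (x y z : vec3) : R := dot (cross x y) z.

(** The unit normal of [v] in the tangent plane at [x]: the covector [cross x v] annihilates [x] and
    [v], and [Qmx] raises it to a tangent vector. *)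
Definition normal (g : geometry) (x v : vec3) : vec3 :=
  apply_mx (Qmx g) (cross x v).

(** Written in coordinates so that [ring] and [nsatz] see polynomials. Scalar multiples appear below
    as [lin a x 0 x] or [lin a x 0 (0, 0, 0)]. *)
Definition lin (a : R) (x : vec3) (b : R) (y : vec3) : vec3 :=
  (a * x1 x + b * x1 y, a * x2 x + b * x2 y, a * x3 x + b * x3 y).

Definition frame (g : geometry) (x v : vec3) : Prop :=
  on_surface g x /\ surface_form g x v = 0 /\ metric g v v = 1.

Ltac coords :=
  unfold on_surface, frame, normal, det, lin, surface_form, metric, apply_mx, coeff_mat, cross, dot in *;
  simpl in *; unfold x1, x2, x3 in *;
  repeat match goal with x : vec3 |- _ => destruct x as [[? ?] ?] end;
  simpl in *.

Lemma vec3_ext (x y : vec3) :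
  x1 x = x1 y -> x2 x = x2 y -> x3 x = x3 y -> x = y.
Proof. coords. congruence. Qed.

Lemma metricE g x y :
  metric g x y = x1 x * x1 y + x2 x * x2 y + Gauss_curvature g * (x3 x * x3 y).
Proof. destruct g; coords; ring. Qed.

Lemma surface_form_self g x : on_surface g x -> surface_form g x x = 1.
Proof. destruct g; coords; intros H; [rewrite H | rewrite <- H | destruct H as [H _]]; nsatz. Qed.

(** Here [y] acts as a covector and Q as the form on covectors: Q = K x x^T + v v^T + n n^T for the
    orthonormal frame x, v, n. *)
Lemma frame_completeness g x v y : frame g x v ->
  metric g y y =
    Gauss_curvature g * dot y x ^ 2 + dot y v ^ 2 + dot y (normal g x v) ^ 2.
Proof.
intros [H1 [H2 H3]]; destruct g; coords.
- nsatz.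
- nsatz.
- destruct H1 as [H1 _]. nsatz.
Qed.

Lemma det_normal g x v : frame g x v -> det x v (normal g x v) = 1.
Proof.
intros [H1 [H2 H3]]; destruct g; coords.
- nsatz.
- nsatz.
- destruct H1 as [H1 _]. nsatz.
Qed.

(** The coefficients on the left are Gram cofactors, so the combination is Q-orthogonal to [x] and
    [y]. It is therefore proportional to the adjugate of Q, diag(K, K, 1), applied to [cross x y],
    also when Q is degenerate. *)
Lemma gram_expansion g x y z :
  let K := Gauss_curvature g in
  let L := metric g in
  let n := cross x y in
  lin (L x x * L y y - L x y ^ 2) z 1
    (lin (L x y * L y z - L y y * L x z) x (L x y * L x z - L x x * L y z) y) =
  lin (det x y z) (K * x1 n, K * x2 n, x3 n) 0 x.
Proof. destruct g; apply vec3_ext; coords; ring. Qed.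

Lemma metric_surface_form g x y :
  Gauss_curvature g * metric g x y =
  Gauss_curvature g * (Gauss_curvature g * surface_form g x y).
Proof. destruct g; coords; ring. Qed.

(** The Frenet equation: with [y] the derivative of the unit velocity [v] and [al] the speed, it
    reads v' = (k * al) n - K * al * x. *)
Lemma frame_decomp g x v y al : frame g x v ->
  surface_form g x y = - Gauss_curvature g * al -> metric g v y = 0 ->
  y = lin (det x v y) (normal g x v) (- Gauss_curvature g * al) x.
Proof.
intros [H1 [H2 H3]] H4 H5.
assert (H1' := surface_form_self g x H1).
assert (G := gram_expansion g x v y). cbv zeta in G.
assert (M1 := metric_surface_form g x x).
assert (M2 := metric_surface_form g x v).
assert (M3 := metric_surface_form g x y).
rewrite H1' in M1; rewrite H2 in M2; rewrite H4 in M3; rewrite H3, H5 in G.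
destruct g; cbn [Gauss_curvature] in *; apply vec3_ext.
(* For K = 0 the Gram identity loses the horizontal components. There [v] and [y] are horizontal,
   and the claim is plane geometry. *)
1-3: clear G M1 M2 M3 H1'; unfold on_surface in H1; unfold surface_form in *;
   cbn [Gauss_curvature] in *; rewrite H1 in *;
   assert (V3 : x3 v = 0) by lra; assert (Y3 : x3 y = 0) by lra;
   coords; subst; nsatz.
1-3: replace (metric Spherical x x) with 1 in G by lra;
   replace (metric Spherical x v) with 0 in G by lra;
   replace (metric Spherical x y) with (- al) in G by lra; injection G; clear; unfold normal;
   generalize (det x v y); coords; intros ? E1 E2 E3; lra.
1-3: replace (metric Hyperbolic x x) with (-1) in G by lra;
   replace (metric Hyperbolic x v) with 0 in G by lra;
   replace (metric Hyperbolic x y) with (- al) in G by lra; injection G; clear; unfold normal;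
   generalize (det x v y); coords; intros ? E1 E2 E3; lra.
Qed.

Lemma det_lin_r x y a z b w : det x y (lin a z b w) = a * det x y z + b * det x y w.
Proof. coords; ring. Qed.
Lemma det_lin_m x y a z b w : det x (lin a z b w) y = a * det x z y + b * det x w y.
Proof. coords; ring. Qed.
Lemma det_swap x y z : det x z y = - det x y z.
Proof. coords; ring. Qed.
Lemma det_diag x y : det x y x = 0 /\ det x y y = 0 /\ det x x y = 0.
Proof. repeat split; coords; ring. Qed.
Lemma det_normal_sym g x v y u : det x v (normal g y u) = det y u (normal g x v).
Proof. destruct g; coords; ring. Qed.

(* [V] and [U] are the derivatives of the unit velocities [v] and [u] along a path,
   [al] and [be] the speeds, and the last two equations of the hypotheses are the
   derivatives of [det B u (A - tA v) = 0] and [det A v (B + tB u) = 0].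
   [det A v (normal g B u)] is the cosine of the angle at the meeting point and
   [det B u v / mA] its sine. *)
Lemma string_variation g A v B u V U tA tB mA mB al be dA dB :
  frame g A v -> frame g B u ->
  let K := Gauss_curvature g in
  surface_form g A V = - K * al -> metric g v V = 0 ->
  surface_form g B U = - K * be -> metric g u U = 0 ->
  lin mA A (- (mA * tA)) v = lin mB B (mB * tB) u ->
  mA ^ 2 * (1 + K * tA ^ 2) = 1 -> mB ^ 2 * (1 + K * tB ^ 2) = 1 ->
  det B U (lin 1 A (- tA) v) + det B u (lin (al - dA) v (- tA) V) = 0 ->
  det A V (lin 1 B tB u) + det A v (lin (be + dB) u tB U) = 0 ->
  det B u v <> 0 ->
  dA / (1 + K * tA ^ 2) + dB / (1 + K * tB ^ 2) - (al - be) =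
  (1 - det A v (normal g B u)) * mA / det B u v *
  (det A v V * tA * mA - det B u U * tB * mB).
Proof.
intros FA FB K HV1 HV2 HU1 HU2 HX HmA HmB HdA HdB Hd.
assert (mA <> 0) by (intros E; rewrite E in HmA; nra).
assert (mB <> 0) by (intros E; rewrite E in HmB; nra).
assert (PA : 1 + K * tA ^ 2 <> 0) by (intros E; rewrite E in HmA; nra).
assert (PB : 1 + K * tB ^ 2 <> 0) by (intros E; rewrite E in HmB; nra).
set (T := det A v (normal g B u)). set (d := det B u v).
assert (DV : det B u V = det A v V * T - K * al * det B u A).
{ rewrite (frame_decomp g A v V al FA HV1 HV2) at 1. rewrite det_lin_r.
  rewrite det_normal_sym. fold T K. ring. }
assert (DU : det A v U = det B u U * T - K * be * det A v B).
{ rewrite (frame_decomp g B u U be FB HU1 HU2) at 1. rewrite det_lin_r.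
  fold T K. ring. }
(* Five scalar consequences of the equality of the two expressions for the meeting point: it is
   paired with both tangent planes, with their variations, and with [cross v u]. *)
assert (E1 := f_equal (det B u) HX). rewrite !det_lin_r in E1.
assert (E2 := f_equal (det A v) HX). rewrite !det_lin_r in E2.
assert (E3 := f_equal (det B U) HX). rewrite !det_lin_r in E3.
assert (E4 := f_equal (det A V) HX). rewrite !det_lin_r in E4.
assert (E5 := f_equal (det v u) HX). rewrite !det_lin_r in E5.
destruct (det_diag A v) as [Z1 [Z2 _]]. destruct (det_diag B u) as [Z3 [Z4 _]].
destruct (det_diag B U) as [Z5 [_ _]]. destruct (det_diag A V) as [Z6 [_ _]].
destruct (det_diag v u) as [Z7 [Z8 _]].
rewrite Z1, Z2 in E2; rewrite Z3, Z4 in E1; rewrite Z5 in E3; rewrite Z6 in E4.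
rewrite Z7, Z8 in E5.
rewrite (det_swap B u U) in E3. rewrite (det_swap A v V) in E4.
replace (det v u A) with (det A v u) in E5 by (coords; ring).
replace (det v u B) with (- d) in E5 by (unfold d; coords; ring).
rewrite !det_lin_r in HdA, HdB. fold d in HdA, E1, Hd.
set (e := det A v u) in *.
set (kA := det A v V) in *. set (kB := det B u U) in *.
rewrite DV in HdA. rewrite DU in HdB.
set (pA := det B u A) in *. set (pB := det A v B) in *.
set (qA := det B U A) in *. set (rA := det B U v) in *.
set (qB := det A V B) in *. set (rB := det A V u) in *.
assert (E1' : pA = tA * d) by (apply (Rmult_eq_reg_l mA); nra).
assert (E2' : pB = - tB * e) by (apply (Rmult_eq_reg_l mB); nra).
assert (E3' : qA - tA * rA = - (mB / mA) * tB * kB).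
{ apply (Rmult_eq_reg_l mA); [field_simplify; [nra|assumption]|assumption]. }
assert (E4' : qB + tB * rB = (mA / mB) * tA * kA).
{ apply (Rmult_eq_reg_l mB); [field_simplify; [nra|assumption]|assumption]. }
assert (E5' : e = - (d * mB / mA)).
{ apply (Rmult_eq_reg_l mA); [field_simplify; [nra|assumption]|assumption]. }
clearbody d e kA kB T pA pB qA rA qB rB K.
assert (e <> 0).
{ intros E; rewrite E in E5'. apply Hd. apply (Rmult_eq_reg_r mB); [|assumption].
  apply (Rmult_eq_reg_r (/ mA)); [|now apply Rinv_neq_0_compat]. unfold Rdiv in E5'; lra. }
(* The differentiated incidence condition is linear in [dA] with coefficient [d]. Dividing by 1 + K
   tA^2 amounts to multiplying by mA^2. [XB] does the same at B. *)
assert (XA : dA / (1 + K * tA ^ 2) = al - mA ^ 2 * (tA * kA * T + mB / mA * tB * kB) / d).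
{ apply (Rmult_eq_reg_r (d * (1 + K * tA ^ 2))); [|now apply Rmult_integral_contrapositive].
  replace (dA / (1 + K * tA ^ 2) * (d * (1 + K * tA ^ 2))) with (dA * d) by (field; assumption).
  transitivity (al * d * (1 + K * tA ^ 2) - (mA ^ 2 * (1 + K * tA ^ 2)) * (tA * kA * T + mB / mA * tB * kB)); [|field; tauto].
  rewrite HmA. rewrite E1' in HdA. lra. }
assert (XB : dB / (1 + K * tB ^ 2) = - be - mB ^ 2 * (mA / mB * tA * kA + tB * kB * T) / e).
{ apply (Rmult_eq_reg_r (e * (1 + K * tB ^ 2))); [|now apply Rmult_integral_contrapositive].
  replace (dB / (1 + K * tB ^ 2) * (e * (1 + K * tB ^ 2))) with (dB * e) by (field; assumption).
  transitivity (- be * e * (1 + K * tB ^ 2) - (mB ^ 2 * (1 + K * tB ^ 2)) * (mA / mB * tA * kA + tB * kB * T)); [|field; tauto].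
  rewrite HmB. rewrite E2' in HdB. lra. }
rewrite XA, XB, E5'. field. tauto.
Qed.

(** * Componentwise derivatives *)

Definition der3 (f : R -> vec3) (s : R) (d : vec3) : Prop :=
  is_derive (fun u => x1 (f u)) s (x1 d) /\
  is_derive (fun u => x2 (f u)) s (x2 d) /\
  is_derive (fun u => x3 (f u)) s (x3 d).

Lemma derive_plus (f h : R -> R) s a b : is_derive f s a -> is_derive h s b ->
  is_derive (fun u => f u + h u) s (a + b).
Proof. intros; now apply (is_derive_plus f h). Qed.

Lemma derive_minus (f h : R -> R) s a b : is_derive f s a -> is_derive h s b ->
  is_derive (fun u => f u - h u) s (a - b).
Proof. intros; now apply (is_derive_minus f h). Qed.

Lemma derive_mult (f h : R -> R) s a b : is_derive f s a -> is_derive h s b ->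
  is_derive (fun u => f u * h u) s (a * h s + f s * b).
Proof. intros; apply (is_derive_mult f h); try assumption. intros; apply Rmult_comm. Qed.

Lemma derive_const (a s : R) : is_derive (fun _ => a) s 0.
Proof. apply (is_derive_const a s). Qed.

Lemma der3_const (x : vec3) s : der3 (fun _ => x) s (0, 0, 0).
Proof. split; [|split]; apply derive_const. Qed.

Ltac derive_coords :=
  repeat match goal with H : der3 _ _ _ |- _ => destruct H as [? [? ?]] end;
  unfold det, lin, surface_form, dot, cross, apply_mx, x1, x2, x3 in *; cbn [fst snd] in *;
  evar_last;
  [ repeat lazymatch goal with
      | |- is_derive (fun u => _ + _) _ _ => eapply derive_plus
      | |- is_derive (fun u => _ - _) _ _ => eapply derive_minus
      | |- is_derive (fun u => _ * _) _ _ => eapply derive_mult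
      | |- is_derive (fun _ => ?c) _ _ => apply derive_const
      | _ => eassumption
      end
  | cbv beta; try ring ].

Lemma der3_det f h k s df dh dk : der3 f s df -> der3 h s dh -> der3 k s dk ->
  is_derive (fun u => det (f u) (h u) (k u)) s
    (det df (h s) (k s) + det (f s) dh (k s) + det (f s) (h s) dk).
Proof. intros; derive_coords. Qed.

Lemma der3_lin a b f h s da db df dh :
  is_derive a s da -> is_derive b s db -> der3 f s df -> der3 h s dh ->
  der3 (fun u => lin (a u) (f u) (b u) (h u)) s
    (lin 1 (lin da (f s) (a s) df) 1 (lin db (h s) (b s) dh)).
Proof. intros Ha Hb Hf Hh; split; [|split]; derive_coords. Qed.

Lemma der3_comp f p u d dp : der3 f (p u) d -> is_derive p u dp ->
  der3 (fun v => f (p v)) u (lin dp d 0 d).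
Proof.
intros [H1 [H2 H3]] Hp; split; [|split]; simpl.
- evar_last; [apply (is_derive_comp (fun t => x1 (f t)) p); eassumption|].
  change (dp * x1 d = dp * x1 d + 0 * x1 d); ring.
- evar_last; [apply (is_derive_comp (fun t => x2 (f t)) p); eassumption|].
  change (dp * x2 d = dp * x2 d + 0 * x2 d); ring.
- evar_last; [apply (is_derive_comp (fun t => x3 (f t)) p); eassumption|].
  change (dp * x3 d = dp * x3 d + 0 * x3 d); ring.
Qed.

Lemma der3_metric g f h s df dh : der3 f s df -> der3 h s dh ->
  is_derive (fun u => metric g (f u) (h u)) s (metric g df (h s) + metric g (f s) dh).
Proof.
intros; eapply is_derive_ext; [intros; symmetry; apply metricE|].
rewrite !metricE; derive_coords.
Qed.

Lemma der3_surface_form g f h s df dh : der3 f s df -> der3 h s dh ->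
  is_derive (fun u => surface_form g (f u) (h u)) s
    (surface_form g df (h s) + surface_form g (f s) dh).
Proof. intros; derive_coords. Qed.

Lemma der3_quadratic M f h s df dh : der3 f s df -> der3 h s dh ->
  is_derive (fun u => dot (apply_mx M (f u)) (h u)) s
    (dot (apply_mx M df) (h s) + dot (apply_mx M (f s)) dh).
Proof. intros; derive_coords. Qed.

Lemma D_der3 f s d : der3 f s d -> D f s = d.
Proof.
intros [H1 [H2 H3]]; unfold D; apply vec3_ext; apply is_derive_unique; assumption.
Qed.

Lemma der3_ext_loc f h s d : locally s (fun u => f u = h u) -> der3 f s d -> der3 h s d.
Proof.
intros E [H1 [H2 H3]]; split; [|split];
 (eapply is_derive_ext_loc; [|eassumption]);
 (eapply filter_imp; [|exact E]); intros u Hu; cbv beta in Hu |- *; now rewrite Hu.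
Qed.

(** * Lengths of geodesic segments *)

(** The length of a geodesic segment as a function of its tangent; for K = -1 the formula is
    artanh. *)
Definition arctan_K (g : geometry) (y : R) : R :=
  match g with
  | Euclidean => y
  | Spherical => atan y
  | Hyperbolic => / 2 * (ln (1 + y) - ln (1 - y))
  end.

Lemma is_derive_arctan_K g y : 0 < 1 + Gauss_curvature g * y ^ 2 ->
  is_derive (arctan_K g) y (/ (1 + Gauss_curvature g * y ^ 2)).
Proof.
destruct g; simpl; intros Hy.
- replace (/ _) with 1 by (field_simplify; lra). apply (is_derive_id y).
- replace (/ _) with (/ (1 + y ^ 2)) by (f_equal; ring).
  apply is_derive_Reals. apply derivable_pt_lim_atan.
- assert (-1 < y < 1) by (split; nra).
  apply (is_derive_ext (fun x : R => / 2 * (ln (1 + x) - ln (1 - x)))); [reflexivity|].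
  auto_derive; [repeat split; lra | field; repeat split; nra].
Qed.

Lemma arctan_K_0 g : arctan_K g 0 = 0.
Proof.
destruct g; simpl; [reflexivity | apply atan_0 |].
rewrite Rplus_0_r, Rminus_0_r; lra.
Qed.

Lemma curvature_pos_le g y z : 0 <= y <= z ->
  0 < 1 + Gauss_curvature g * z ^ 2 -> 0 < 1 + Gauss_curvature g * y ^ 2.
Proof. destruct g; simpl; nra. Qed.

Lemma metric_lin g p x q v :
  metric g (lin p x q v) (lin p x q v) =
  p ^ 2 * metric g x x + 2 * p * q * metric g x v + q ^ 2 * metric g v v.
Proof. rewrite !metricE; coords; ring. Qed.

(** The point at signed distance [arctan_K g y] from [x] in the direction [v]: [h] is the cosine
    (hyperbolic cosine, or 1) of that distance and [h * y] its sine (hyperbolic sine, or length). *)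
Definition geodesic_point (g : geometry) (x v : vec3) (y : R) : vec3 :=
  let h := / sqrt (1 + Gauss_curvature g * y ^ 2) in lin h x (h * y) v.

Lemma radial_proj_lin g x v p q : frame g x v -> 0 < p ->
  0 < 1 + Gauss_curvature g * (q / p) ^ 2 ->
  radial_proj g (lin p x q v) = geodesic_point g x v (q / p).
Proof.
intros F Hp Hy.
assert (F' := F). destruct F as [H1 [H2 H3]].
assert (M1 := metric_surface_form g x x).
assert (M2 := metric_surface_form g x v).
rewrite (surface_form_self g x H1) in M1. rewrite H2 in M2.
destruct g.
- unfold geodesic_point; simpl.
  replace (1 + 0 * _) with 1 by ring. rewrite sqrt_1, Rinv_1.
  unfold on_surface in H1.
  assert (x3 v = 0) by (unfold surface_form in H2; simpl in H2; nra).
  apply vec3_ext; unfold x1, x2, x3 in *; simpl; unfold scal; simpl; unfold mult; simpl;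
   rewrite H1, H; field; lra.
- unfold geodesic_point, radial_proj.
  replace (metric Spherical (lin p x q v) (lin p x q v))
    with (p ^ 2 * (1 + 1 * (q / p) ^ 2)).
  2: { rewrite metric_lin, H3. cbn [Gauss_curvature] in *.
    replace (metric Spherical x x) with 1 by lra.
    replace (metric Spherical x v) with 0 by lra. field; lra. }
  rewrite sqrt_mult, sqrt_pow2 by (simpl in Hy; nra).
  simpl (Gauss_curvature Spherical) in *.
  assert (0 < sqrt (1 + 1 * (q / p) ^ 2)) by now apply sqrt_lt_R0.
  set (h := sqrt _) in *.
  apply vec3_ext; unfold x1, x2, x3 in *; simpl; unfold scal; simpl; unfold mult; simpl;
   field; lra.
- unfold geodesic_point, radial_proj.
  replace (- metric Hyperbolic (lin p x q v) (lin p x q v))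
    with (p ^ 2 * (1 + -1 * (q / p) ^ 2)).
  2: { rewrite metric_lin, H3. cbn [Gauss_curvature] in *.
    replace (metric Hyperbolic x x) with (-1) by lra.
    replace (metric Hyperbolic x v) with 0 by lra. field; lra. }
  simpl (Gauss_curvature Hyperbolic) in *.
  rewrite sqrt_mult, sqrt_pow2 by nra.
  assert (0 < sqrt (1 + -1 * (q / p) ^ 2)) by now apply sqrt_lt_R0.
  set (h := sqrt _) in *.
  apply vec3_ext; unfold x1, x2, x3 in *; simpl; unfold scal; simpl; unfold mult; simpl;
   field; lra.
Qed.

Lemma is_derive_geodesic_point g x v y :
  0 < 1 + Gauss_curvature g * y ^ 2 ->
  let h := / sqrt (1 + Gauss_curvature g * y ^ 2) in
  der3 (geodesic_point g x v) y (lin (- Gauss_curvature g * y * h ^ 3) x (h ^ 3) v).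
Proof.
intros Hy h.
set (K := Gauss_curvature g) in *.
assert (Hs : 0 < sqrt (1 + K * y ^ 2)) by now apply sqrt_lt_R0.
assert (Hs2 : sqrt (1 + K * y ^ 2) ^ 2 = 1 + K * y ^ 2) by (apply pow2_sqrt; lra).
assert (Dh : is_derive (fun y => / sqrt (1 + K * y ^ 2)) y (- K * y * h ^ 3)).
{ auto_derive; [split; [simpl in *; lra | split; [simpl in *; lra | trivial]]|].
  unfold h. set (r := sqrt _) in *.
  replace (sqrt _) with r by (unfold r; f_equal; ring). field. lra. }
assert (Dhy : is_derive (fun y => / sqrt (1 + K * y ^ 2) * y) y (h ^ 3)).
{ evar_last. { apply derive_mult; [exact Dh | apply (is_derive_id y)]. }
  cbv beta. fold h. change (one) with 1.
  assert (h ^ 2 * (1 + K * y ^ 2) = 1) by (rewrite <- Hs2; unfold h; field; lra).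
  transitivity (h * (1 - K * y ^ 2 * h ^ 2)); [ring|].
  transitivity (h * h ^ 2); [f_equal; lra | ring]. }
assert (E := der3_lin _ _ (fun _ => x) (fun _ => v) y _ _ (0,0,0) (0,0,0) Dh Dhy).
match type of E with _ -> _ -> der3 _ _ ?d => replace (lin (- K * y * h ^ 3) x (h ^ 3) v) with d end.
{ exact (E (der3_const x y) (der3_const v y)). }
apply vec3_ext; coords; ring.
Qed.

(** The chord point is [p s] times [x] plus [q s] times [v], so its projection lies at tangent q/p.
    The speed of the segment is thus the derivative of [arctan_K g (q s / p s)], and the fundamental
    theorem of calculus gives the length. *)
Lemma segment_length_frame g x v m t :
  frame g x v -> 0 < m -> 0 <= t -> m ^ 2 * (1 + Gauss_curvature g * t ^ 2) = 1 ->
  segment_length g x (lin m x (m * t) v) = arctan_K g t.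
Proof.
intros F Hm Ht Hmt.
assert (F' := F). destruct F as [H1 [H2 H3]].
set (K := Gauss_curvature g) in *.
assert (HKt : 0 < 1 + K * t ^ 2) by nra.
pose (p s := 1 - s + s * m). pose (q s := s * m * t).
assert (Pp : forall s, 0 <= s <= 1 -> 0 < p s).
{ intros s Hs; unfold p. destruct (Req_dec s 0) as [->|]; [lra|].
  assert (0 < s * m) by (apply Rmult_lt_0_compat; lra). lra. }
assert (Py : forall s, 0 <= s <= 1 -> 0 < 1 + K * (q s / p s) ^ 2).
{ intros s Hs. apply curvature_pos_le with t; [|exact HKt].
  specialize (Pp s Hs). assert (0 <= s * m) by nra.
  unfold q; split.
  - apply Rmult_le_pos; [nra|]. now apply Rlt_le, Rinv_0_lt_compat.
  - apply Rmult_le_reg_r with (p s); [assumption|].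
    unfold Rdiv; rewrite Rmult_assoc, Rinv_l by lra. unfold p; nra. }
assert (Eg : forall s, 0 <= s <= 1 ->
  geodesic_segment g x (lin m x (m * t) v) s = geodesic_point g x v (q s / p s)).
{ intros s Hs; unfold geodesic_segment.
  rewrite <- radial_proj_lin by auto. f_equal. unfold p, q.
  apply vec3_ext; unfold x1, x2, x3; simpl; unfold plus, scal; simpl;
    unfold mult; simpl; unfold x1, x2, x3; ring. }
assert (Dq : forall s, 0 <= s <= 1 -> is_derive (fun s => q s / p s) s (m * t / p s ^ 2)).
{ intros s Hs; specialize (Pp s Hs); unfold p, q in *.
  auto_derive; [lra|]. field; lra. }
pose (df s := m * t / p s ^ 2 * / (1 + K * (q s / p s) ^ 2)).
assert (Dd : forall s, 0 <= s <= 1 ->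
  is_derive (fun s => arctan_K g (q s / p s)) s (df s)).
{ intros s Hs.
  apply (is_derive_comp (arctan_K g) (fun s => q s / p s)); [|now apply Dq].
  now apply is_derive_arctan_K; apply Py. }
unfold segment_length, arc_length.
transitivity (RInt df 0 1).
{ apply RInt_ext. rewrite Rmin_left, Rmax_right by lra. intros s Hs.
  assert (Hs' : 0 <= s <= 1) by lra.
  assert (E : der3 (geodesic_segment g x (lin m x (m * t) v)) s
    (let h := / sqrt (1 + K * (q s / p s) ^ 2) in
     lin (m * t / p s ^ 2) (lin (- K * (q s / p s) * h ^ 3) x (h ^ 3) v)
      0 (lin (- K * (q s / p s) * h ^ 3) x (h ^ 3) v))).
  { apply der3_ext_loc with (fun s => geodesic_point g x v (q s / p s)).
    (* [Eg] is known on [0, 1] only; this radius keeps the neighbourhood inside. *)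
    - exists (mkposreal (Rmin s (1 - s)) ltac:(apply Rmin_pos; lra)).
      intros u Hu. symmetry; apply Eg.
      unfold ball in Hu; simpl in Hu; unfold AbsRing_ball, abs, minus, plus, opp in Hu; simpl in Hu.
      assert (A1 := Rmin_l s (1 - s)). assert (A2 := Rmin_r s (1 - s)).
      apply Rabs_def2 in Hu. lra.
    - apply der3_comp; [|now apply Dq].
      apply is_derive_geodesic_point. now apply Py. }
  rewrite (D_der3 _ _ _ E). cbv zeta.
  specialize (Pp s Hs'); specialize (Py s Hs').
  unfold df, norm_Q.
  set (y := q s / p s) in *.
  assert (Hr : 0 < sqrt (1 + K * y ^ 2)) by now apply sqrt_lt_R0.
  assert (Hr2 : sqrt (1 + K * y ^ 2) ^ 2 = 1 + K * y ^ 2) by (apply pow2_sqrt; lra).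
  set (r := sqrt (1 + K * y ^ 2)) in *.
  rewrite <- (sqrt_pow2 (m * t / p s ^ 2 * / (1 + K * y ^ 2))).
  2: { apply Rmult_le_pos; [apply Rmult_le_pos; [nra|]|]; apply Rlt_le, Rinv_0_lt_compat; [|lra].
       now apply pow_lt. }
  f_equal. rewrite !metric_lin, H3.
  assert (M1 := metric_surface_form g x x).
  assert (M2 := metric_surface_form g x v).
  rewrite (surface_form_self g x H1) in M1. rewrite H2 in M2.
  assert (HH : K ^ 2 * y ^ 2 * metric g x x - 2 * K * y * metric g x v + 1 = r ^ 2).
  { rewrite Hr2. fold K in M1, M2.
    transitivity (K * (K * metric g x x) * y ^ 2 - 2 * (K * metric g x v) * y + 1); [ring|].
    rewrite M1, M2. unfold K; destruct g; simpl; ring. }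
  set (a := m * t / p s ^ 2).
  transitivity (a ^ 2 * / r ^ 6 *
    (K ^ 2 * y ^ 2 * metric g x x - 2 * K * y * metric g x v + 1)); [field; lra|].
  rewrite HH, <- Hr2. field; lra. }
apply is_RInt_unique.
replace (arctan_K g t) with (minus (arctan_K g (q 1 / p 1)) (arctan_K g (q 0 / p 0))).
{ apply (is_RInt_derive (fun s => arctan_K g (q s / p s))).
  - rewrite Rmin_left, Rmax_right by lra. exact Dd.
  - rewrite Rmin_left, Rmax_right by lra. intros s Hs.
    specialize (Pp s Hs); specialize (Py s Hs). 
    apply (ex_derive_continuous (V := R_NormedModule)).
    unfold df. unfold p, q in *. auto_derive.
    match goal with |- _ /\ _ /\ ?X <> 0 /\ _ =>
      replace X with (1 + K * (s * m * t / (1 - s + s * m)) ^ 2) by (field; lra) end.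
    repeat split; nra. }
replace (q 1 / p 1) with t by (unfold p, q; field; lra).
replace (q 0 / p 0) with 0 by (unfold p, q; field; lra).
rewrite arctan_K_0. unfold minus, plus, opp; simpl. ring.
Qed.

(** * Pairs of tangent geodesics of a convex arc *)

(* [e] is the sign of the signed curvature.  [arc_short] makes the tangent geodesics
   meet also in the hyperbolic plane. *)
Record convex_arc (g : geometry) (c : R -> vec3) (e lo hi : R) : Prop := {
  arc_sign : e ^ 2 = 1;
  arc_velocity : forall s, lo < s < hi -> der3 c s (D c s);
  arc_acceleration : forall s, lo < s < hi -> der3 (D c) s (D (D c) s);
  arc_surface : forall s, lo < s < hi -> on_surface g (c s);
  arc_regular : forall s, lo < s < hi -> 0 < metric g (D c s) (D c s);
  arc_convex : forall a b, lo < a < hi -> lo < b < hi ->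
    0 < e * det (c b) (D c b) (D (D c) a);
  arc_short : forall s, lo < s < hi ->
    0 < 1 + Gauss_curvature g * (norm_Q g (D c s) * (hi - lo)) ^ 2 }.

(** A strictly convex function with a double zero at [b]. The last inequality says that its tangent
    line at [a] is negative at [b]; it follows from the derivative (s - b) f''(s) of (s - b) f'(s) -
    f(s). *)
Lemma convex_contact (f f1 f2 : R -> R) lo hi b a :
  (forall s, lo < s < hi -> is_derive f s (f1 s)) ->
  (forall s, lo < s < hi -> is_derive f1 s (f2 s)) ->
  (forall s, lo < s < hi -> 0 < f2 s) ->
  lo < b < hi -> lo < a < hi -> a <> b -> f b = 0 -> f1 b = 0 ->
  0 < f a /\ 0 < (a - b) * f1 a /\ f a < (a - b) * f1 a.
Proof.
intros D0 D1 P2 Hb Ha Hab F0 F1.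
assert (P1 : forall s, lo < s < hi -> s <> b -> 0 < (s - b) * f1 s).
{ intros s Hs Hsb. destruct (Rtotal_order s b) as [H | [H | H]]; [|easy|].
  - destruct (MVT_cor2 f1 f2 s b H) as [x [E Hx]].
    { intros; apply is_derive_Reals, D1; lra. }
    assert (0 < f2 x) by (apply P2; lra). rewrite F1 in E.
    assert (f1 s < 0) by nra. nra.
  - destruct (MVT_cor2 f1 f2 b s H) as [x [E Hx]].
    { intros; apply is_derive_Reals, D1; lra. }
    assert (0 < f2 x) by (apply P2; lra). rewrite F1 in E.
    assert (0 < f1 s) by nra. nra. }
assert (D3 : forall s, lo < s < hi ->
  is_derive (fun s => (s - b) * f1 s - f s) s ((s - b) * f2 s)).
{ intros s Hs. evar_last.
  - apply derive_minus; [|now apply D0].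
    apply derive_mult; [|now apply D1].
    apply derive_minus; [apply (is_derive_id s) | apply derive_const].
  - cbv beta. change one with 1. ring. }
split; [|split; [now apply P1|]].
- destruct (Rtotal_order a b) as [H | [H | H]]; [|easy|].
  + destruct (MVT_cor2 f f1 a b H) as [x [E Hx]].
    { intros; apply is_derive_Reals, D0; lra. }
    assert (0 < (x - b) * f1 x) by (apply P1; lra). rewrite F0 in E.
    assert (f1 x < 0) by nra. nra.
  + destruct (MVT_cor2 f f1 b a H) as [x [E Hx]].
    { intros; apply is_derive_Reals, D0; lra. }
    assert (0 < (x - b) * f1 x) by (apply P1; lra). rewrite F0 in E.
    assert (0 < f1 x) by nra. nra.
- apply Rminus_lt_0.
  destruct (Rtotal_order a b) as [H | [H | H]]; [|easy|].
  + destruct (MVT_cor2 (fun s => (s - b) * f1 s - f s) (fun s => (s - b) * f2 s) a b H)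
      as [x [E Hx]].
    { intros; apply is_derive_Reals, D3; lra. }
    assert (0 < f2 x) by (apply P2; lra). rewrite F0, F1 in E.
    assert (0 < (b - x) * f2 x) by (apply Rmult_lt_0_compat; lra). nra.
  + destruct (MVT_cor2 (fun s => (s - b) * f1 s - f s) (fun s => (s - b) * f2 s) b a H)
      as [x [E Hx]].
    { intros; apply is_derive_Reals, D3; lra. }
    assert (0 < f2 x) by (apply P2; lra). rewrite F0, F1 in E.
    assert (0 < (x - b) * f2 x) by (apply Rmult_lt_0_compat; lra). nra.
Qed.

(** For fixed [b] the function e * det (c b, c' b, c s) measures the position of [c s] relative to
    the tangent plane at [b]. It has a double zero at [b], and the two-parameter form of
    [arc_convex] makes it strictly convex on the whole arc. *)
Lemma arc_contact g c e lo hi a b : convex_arc g c e lo hi ->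
  lo < a < hi -> lo < b < hi -> a <> b ->
  0 < e * det (c b) (D c b) (c a) /\
  0 < (a - b) * (e * det (c b) (D c b) (D c a)) /\
  e * det (c b) (D c b) (c a) < (a - b) * (e * det (c b) (D c b) (D c a)).
Proof.
intros HA Ha Hb Hab.
apply (convex_contact (fun s => e * det (c b) (D c b) (c s))
  (fun s => e * det (c b) (D c b) (D c s)) (fun s => e * det (c b) (D c b) (D (D c) s)) lo hi);
  try assumption.
- intros s Hs. evar_last.
  + apply derive_mult; [apply derive_const|].
    apply der3_det; [apply der3_const | apply der3_const | now apply (arc_velocity _ _ _ _ _ HA)].
  + unfold det, dot, cross, x1, x2, x3; simpl; ring.
- intros s Hs. evar_last.
  + apply derive_mult; [apply derive_const|].
    apply der3_det; [apply der3_const | apply der3_const | now apply (arc_acceleration _ _ _ _ _ HA)].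
  + unfold det, dot, cross, x1, x2, x3; simpl; ring.
- intros s Hs; now apply (arc_convex _ _ _ _ _ HA).
- destruct (det_diag (c b) (D c b)) as [E _]; rewrite E; ring.
- destruct (det_diag (c b) (D c b)) as [_ [E _]]; rewrite E; ring.
Qed.

(* The tangent geodesics at [c s] and [c o] meet on the ray of [c s - rho c s o * c' s];
   [rho c s o] has the sign of [s - o]. *)
Definition rho (c : R -> vec3) (s o : R) : R :=
  det (c o) (D c o) (c s) / det (c o) (D c o) (D c s).

(** By the last inequality of [arc_contact], the line c s - k c' s crosses the tangent plane at [o]
    for some k strictly between 0 and s - o. This bound replaces any limit of [rho] on the
    diagonal. *)
Lemma rho_bounds g c e lo hi s o : convex_arc g c e lo hi ->
  lo < s < hi -> lo < o < hi -> s <> o ->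
  det (c o) (D c o) (D c s) <> 0 /\ 0 < rho c s o / (s - o) < 1.
Proof.
intros HA Hs Ho Hso.
destruct (arc_contact g c e lo hi s o HA Hs Ho Hso) as [P1 [P2 P3]].
unfold rho.
set (d0 := det (c o) (D c o) (c s)) in *. set (d1 := det (c o) (D c o) (D c s)) in *.
assert (d1 <> 0) by (intros E; rewrite E in P2; lra).
assert (s - o <> 0) by lra.
assert (e <> 0) by (intros E; rewrite E in P1; lra).
split; [assumption|].
replace (d0 / d1 / (s - o)) with (e * d0 / ((s - o) * (e * d1))) by (field; auto).
split.
- apply Rdiv_lt_0_compat; assumption.
- apply Rmult_lt_reg_r with ((s - o) * (e * d1)); [assumption|].
  unfold Rdiv; rewrite Rmult_assoc, Rinv_l by lra. lra.
Qed.

(* [tau g c s o] is the tangent, resp. the hyperbolic tangent, of the signed length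
   from the meeting point to [c s]. *)
Definition tau (g : geometry) (c : R -> vec3) (s o : R) : R :=
  norm_Q g (D c s) * rho c s o.

(** The cosine, resp. hyperbolic cosine, of the distance from [c s] to the meeting point (1 in the
    Euclidean case). Up to sign, [tau g c s o * scale g c s o] is the quantity S_A of the
    overview. *)
Definition scale (g : geometry) (c : R -> vec3) (s o : R) : R :=
  / sqrt (1 + Gauss_curvature g * tau g c s o ^ 2).

Definition tangent_meet (g : geometry) (c : R -> vec3) (s o : R) : vec3 :=
  let m := scale g c s o in lin m (c s) (- (m * rho c s o)) (D c s).

Lemma speed_pos g c e lo hi s : convex_arc g c e lo hi -> lo < s < hi ->
  0 < norm_Q g (D c s).
Proof. intros HA Hs; apply sqrt_lt_R0; now apply (arc_regular _ _ _ _ _ HA). Qed.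

Lemma speed_sqr g c e lo hi s : convex_arc g c e lo hi -> lo < s < hi ->
  norm_Q g (D c s) ^ 2 = metric g (D c s) (D c s).
Proof.
intros HA Hs; apply pow2_sqrt; apply Rlt_le; now apply (arc_regular _ _ _ _ _ HA).
Qed.

Lemma abs_curvature_le g y z : y ^ 2 <= z ^ 2 ->
  0 < 1 + Gauss_curvature g * z ^ 2 -> 0 < 1 + Gauss_curvature g * y ^ 2.
Proof. destruct g; simpl; nra. Qed.

(** In the hyperbolic plane this is |tau| < 1: the line common to the two planes does hit the
    surface. It holds because |rho| is below hi - lo, the length used in [arc_short]. *)
Lemma tau_curvature g c e lo hi s o : convex_arc g c e lo hi ->
  lo < s < hi -> lo < o < hi -> s <> o ->
  0 < 1 + Gauss_curvature g * tau g c s o ^ 2.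
Proof.
intros HA Hs Ho Hso.
destruct (rho_bounds _ _ _ _ _ _ _ HA Hs Ho Hso) as [_ Hr].
apply abs_curvature_le with (norm_Q g (D c s) * (hi - lo)); [|now apply (arc_short _ _ _ _ _ HA)].
unfold tau. rewrite !Rpow_mult_distr. apply Rmult_le_compat_l; [apply pow2_ge_0|].
replace (rho c s o) with (rho c s o / (s - o) * (s - o)) by (field; lra).
set (r := rho c s o / (s - o)) in *.
assert (r ^ 2 <= 1) by nra. assert (0 <= (s - o) ^ 2) by apply pow2_ge_0.
assert ((s - o) ^ 2 <= (hi - lo) ^ 2) by nra. nra.
Qed.

Lemma scale_pos g c e lo hi s o : convex_arc g c e lo hi ->
  lo < s < hi -> lo < o < hi -> s <> o ->
  0 < scale g c s o /\
  scale g c s o ^ 2 * (1 + Gauss_curvature g * tau g c s o ^ 2) = 1.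
Proof.
intros HA Hs Ho Hso.
assert (H := tau_curvature _ _ _ _ _ _ _ HA Hs Ho Hso).
unfold scale. assert (0 < sqrt (1 + Gauss_curvature g * tau g c s o ^ 2)) by now apply sqrt_lt_R0.
split; [now apply Rinv_0_lt_compat|].
rewrite <- (pow2_sqrt (1 + Gauss_curvature g * tau g c s o ^ 2)) at 2 by lra. field; lra.
Qed.

Lemma locally_between lo hi s : lo < s < hi -> locally s (fun u => lo < u < hi).
Proof. exact (open_and _ _ (open_gt lo) (open_lt hi) s). Qed.

Lemma is_derive_locally_const f s l k :
  is_derive f s l -> locally s (fun u => f u = k) -> l = 0.
Proof.
intros H E. rewrite <- (is_derive_unique f s l H).
rewrite (Derive_ext_loc f (fun _ => k) s E). apply Derive_const.
Qed.

Lemma surface_form_sym g x y : surface_form g x y = surface_form g y x.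
Proof. unfold surface_form; ring. Qed.

Lemma metric_sym g x y : metric g x y = metric g y x.
Proof. rewrite !metricE; ring. Qed.

Lemma velocity_tangent g c s : der3 c s (D c s) -> locally s (fun u => on_surface g (c u)) ->
  surface_form g (c s) (D c s) = 0.
Proof.
intros Dc L.
assert (E := is_derive_locally_const _ s _ 1 (der3_surface_form g _ _ _ _ _ Dc Dc)).
rewrite (surface_form_sym g (D c s)) in E.
enough (surface_form g (c s) (D c s) + surface_form g (c s) (D c s) = 0) by lra.
apply E. eapply filter_imp; [|exact L]. intros u. apply surface_form_self.
Qed.

Lemma arc_tangent g c e lo hi s : convex_arc g c e lo hi -> lo < s < hi ->
  surface_form g (c s) (D c s) = 0.
Proof.
intros HA Hs. apply velocity_tangent; [now apply (arc_velocity _ _ _ _ _ HA)|].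
apply (filter_imp (fun u => lo < u < hi)); [|now apply locally_between].
exact (arc_surface _ _ _ _ _ HA).
Qed.

Definition unit_velocity (g : geometry) (c : R -> vec3) (s : R) : vec3 :=
  lin (/ norm_Q g (D c s)) (D c s) 0 (0, 0, 0).

Lemma velocity_lin g c e lo hi s : convex_arc g c e lo hi -> lo < s < hi ->
  D c s = lin (norm_Q g (D c s)) (unit_velocity g c s) 0 (0, 0, 0).
Proof.
intros HA Hs. assert (H := speed_pos _ _ _ _ _ _ HA Hs).
unfold unit_velocity. set (r := norm_Q g (D c s)) in *. clearbody r.
set (w := D c s) in *; clearbody w.
apply vec3_ext; coords; field; lra.
Qed.

Lemma unit_velocity_frame g c e lo hi s : convex_arc g c e lo hi -> lo < s < hi ->
  frame g (c s) (unit_velocity g c s).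
Proof.
intros HA Hs. split; [|split].
- now apply (arc_surface _ _ _ _ _ HA).
- assert (H := arc_tangent _ _ _ _ _ _ HA Hs).
  transitivity (/ norm_Q g (D c s) * surface_form g (c s) (D c s)).
  + unfold unit_velocity, surface_form, lin, x1, x2, x3; simpl; ring.
  + rewrite H; ring.
- unfold unit_velocity. rewrite metric_lin, <- (speed_sqr _ _ _ _ _ _ HA Hs).
  assert (H := speed_pos _ _ _ _ _ _ HA Hs). field; lra.
Qed.

Lemma frame_opp g x v : frame g x v -> frame g x (lin (-1) v 0 (0, 0, 0)).
Proof.
intros [H1 [H2 H3]]; split; [assumption|split].
- transitivity (- surface_form g x v); [|lra].
  unfold surface_form, lin, x1, x2, x3; simpl; ring.
- rewrite metric_lin, H3; ring.
Qed.

Lemma geodesic_point_on_surface g x v y : frame g x v ->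
  0 < 1 + Gauss_curvature g * y ^ 2 -> on_surface g (geodesic_point g x v y).
Proof.
intros [H1 [H2 H3]] Hy.
assert (Hs : 0 < sqrt (1 + Gauss_curvature g * y ^ 2)) by now apply sqrt_lt_R0.
assert (Hs2 : sqrt (1 + Gauss_curvature g * y ^ 2) ^ 2 = 1 + Gauss_curvature g * y ^ 2)
  by (apply pow2_sqrt; lra).
unfold geodesic_point. set (r := sqrt _) in *.
destruct g; cbn [Gauss_curvature] in *.
- assert (r = 1) by nra. unfold on_surface in *.
  unfold surface_form in H2; cbn [Gauss_curvature] in H2. rewrite H1 in H2.
  unfold lin, x3; simpl. fold (x3 x) (x3 v). rewrite H1, H. 
  replace (x3 v) with 0 by lra. field.
- assert (H4 : (/ r) ^ 2 * (1 + 1 * y ^ 2) = 1) by (rewrite <- Hs2; field; lra).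
  set (h := / r) in *; clearbody h; clear r Hs Hs2 Hy. coords. nsatz.
- assert (H4 : (/ r) ^ 2 * (1 + -1 * y ^ 2) = 1) by (rewrite <- Hs2; field; lra).
  assert (Hh : 0 < / r) by now apply Rinv_0_lt_compat.
  set (h := / r) in *; clearbody h; clear r Hs Hs2.
  unfold on_surface in *; destruct H1 as [H1 P].
  split; [clear Hy Hh P; coords; nsatz|].
  (* The upper sheet of the hyperboloid: Lagrange's identity in the horizontal plane gives this
     bound, and since |y| < 1 the sum x3 x + y * x3 v stays positive. *)
  assert (B : x3 v ^ 2 <= x3 x ^ 2 - 1).
  { clear Hy Hh H4 h y.
    rewrite metricE in H3; unfold surface_form in H2; cbn [Gauss_curvature] in *.
    assert (C0 : 0 <= (x1 x * x2 v - x2 x * x1 v) ^ 2) by apply pow2_ge_0.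
    assert (C1 : (x1 x * x2 v - x2 x * x1 v) ^ 2 =
      (x1 x ^ 2 + x2 x ^ 2) * (x1 v ^ 2 + x2 v ^ 2) - (x1 x * x1 v + x2 x * x2 v) ^ 2) by ring.
    replace (x1 x * x1 v + x2 x * x2 v) with (x3 x * x3 v) in C1 by lra.
    replace (x1 x ^ 2 + x2 x ^ 2) with (x3 x ^ 2 - 1) in C1 by lra.
    replace (x1 v ^ 2 + x2 v ^ 2) with (1 + x3 v ^ 2) in C1 by lra. lra. }
  assert (0 < x3 x + y * x3 v).
  { assert ((y * x3 v) ^ 2 <= x3 v ^ 2)
      by (assert (0 <= x3 v ^ 2) by apply pow2_ge_0; rewrite Rpow_mult_distr; nra).
    nra. }
  replace (x3 (lin h x (h * y) v)) with (h * (x3 x + y * x3 v)) by (unfold lin, x3; simpl; ring).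
  now apply Rmult_lt_0_compat.
Qed.

Lemma tangent_meet_geodesic_point g c e lo hi s o : convex_arc g c e lo hi -> lo < s < hi ->
  tangent_meet g c s o = geodesic_point g (c s) (unit_velocity g c s) (- tau g c s o).
Proof.
intros HA Hs. unfold tangent_meet, geodesic_point.
replace ((- tau g c s o) ^ 2) with (tau g c s o ^ 2) by ring. fold (scale g c s o).
rewrite (velocity_lin _ _ _ _ _ _ HA Hs) at 1.
unfold tau. set (v := unit_velocity g c s). clearbody v.
set (m := scale g c s o); clearbody m. set (r := rho c s o); clearbody r.
set (x := c s); clearbody x.
set (n := norm_Q _ _); clearbody n. apply vec3_ext; coords; ring.
Qed.

(** Two expansions of the vector product of [cross B u] and [cross A v], which spans the line common
    to the planes of (A, v) and (B, u). *)
Lemma triple_product A v B u :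
  lin (det B u v) A (- det B u A) v = lin (- det A v u) B (det A v B) u.
Proof. apply vec3_ext; coords; ring. Qed.

Lemma tangent_lines_meet A v B u : det B u v <> 0 -> det A v u <> 0 ->
  lin 1 A (- (det B u A / det B u v)) v =
  lin (- det A v u / det B u v) (lin 1 B (- (det A v B / det A v u)) u) 0 B.
Proof.
intros H1 H2. assert (T := triple_product A v B u).
generalize dependent (det B u v); generalize dependent (det A v u).
generalize (det B u A) (det A v B). intros d0 d3 d2 H2 d1 H1 T.
assert (T1 := f_equal x1 T). assert (T2 := f_equal x2 T). assert (T3 := f_equal x3 T).
unfold lin, x1, x2, x3 in *; simpl in *.
apply vec3_ext; unfold x1, x2, x3; simpl; apply (Rmult_eq_reg_l d1); try assumption.
- eapply eq_trans; [|eapply eq_trans; [exact T1|]]; field; tauto.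
- eapply eq_trans; [|eapply eq_trans; [exact T2|]]; field; tauto.
- eapply eq_trans; [|eapply eq_trans; [exact T3|]]; field; tauto.
Qed.

Lemma surface_form_tangent g x w : on_surface g x -> surface_form g x w = 0 ->
  surface_form g w w = Gauss_curvature g * metric g w w.
Proof.
intros H1 H2; destruct g.
- unfold on_surface in H1; unfold surface_form in *; cbn [Gauss_curvature] in *.
  rewrite H1 in H2. replace (x3 w) with 0 by lra. ring.
- coords; ring.
- coords; ring.
Qed.

Lemma surface_form_lin g p x q v :
  surface_form g (lin p x q v) (lin p x q v) =
  p ^ 2 * surface_form g x x + 2 * p * q * surface_form g x v + q ^ 2 * surface_form g v v.
Proof. unfold surface_form, lin, x1, x2, x3; simpl; ring. Qed.

Lemma tangent_form g c e lo hi s p q : convex_arc g c e lo hi -> lo < s < hi ->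
  surface_form g (lin p (c s) q (D c s)) (lin p (c s) q (D c s)) =
  p ^ 2 + Gauss_curvature g * (norm_Q g (D c s) * q) ^ 2.
Proof.
intros HA Hs.
assert (S := arc_surface _ _ _ _ _ HA s Hs).
assert (T := arc_tangent _ _ _ _ _ _ HA Hs).
rewrite surface_form_lin, (surface_form_self g _ S), T, (surface_form_tangent g _ _ S T).
rewrite <- (speed_sqr _ _ _ _ _ _ HA Hs). ring.
Qed.

(** Both points lie on the line common to the two planes and have [surface_form] 1, so they are
    equal or opposite. Convexity makes the factor [k] between the unnormalized vectors positive,
    which excludes opposite points. *)
Lemma tangent_meet_sym g c e lo hi a b : convex_arc g c e lo hi ->
  lo < a < hi -> lo < b < hi -> a <> b ->
  tangent_meet g c a b = tangent_meet g c b a.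
Proof.
intros HA Ha Hb Hab.
assert (Hba : b <> a) by auto.
destruct (arc_contact _ _ _ _ _ _ _ HA Ha Hb Hab) as [_ [P1 _]].
destruct (arc_contact _ _ _ _ _ _ _ HA Hb Ha Hba) as [_ [P2 _]].
destruct (scale_pos _ _ _ _ _ _ _ HA Ha Hb Hab) as [M1 M1'].
destruct (scale_pos _ _ _ _ _ _ _ HA Hb Ha Hba) as [M2 M2'].
destruct (rho_bounds _ _ _ _ _ _ _ HA Ha Hb Hab) as [N1 _].
destruct (rho_bounds _ _ _ _ _ _ _ HA Hb Ha Hba) as [N2 _].
assert (F1 := tangent_form _ _ _ _ _ _ 1 (- rho c a b) HA Ha).
assert (F2 := tangent_form _ _ _ _ _ _ 1 (- rho c b a) HA Hb).
assert (E : lin 1 (c a) (- rho c a b) (D c a) =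
  lin (- det (c a) (D c a) (D c b) / det (c b) (D c b) (D c a))
    (lin 1 (c b) (- rho c b a) (D c b)) 0 (c b)).
{ now apply tangent_lines_meet. }
set (k := - det (c a) (D c a) (D c b) / det (c b) (D c b) (D c a)) in *.
assert (Hk : 0 < k).
{ set (d1 := det (c b) (D c b) (D c a)) in *. set (d2 := det (c a) (D c a) (D c b)) in *.
  assert (e <> 0) by (intros E0; rewrite E0 in P1; lra).
  replace k with ((b - a) * (e * d2) / ((a - b) * (e * d1))) by (unfold k; field; lra).
  now apply Rdiv_lt_0_compat. }
rewrite E in F1. rewrite surface_form_lin, F2 in F1.
set (mA := scale g c a b) in *. set (mB := scale g c b a) in *.
assert (G : mA * k = mB).
{ unfold tau in M1', M2'.
  set (nA := 1 + _) in M1'. set (nB := 1 + _) in M2'.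
  assert (Q : nA = k ^ 2 * nB) by (unfold nA, nB; lra).
  assert ((mA * k) ^ 2 * nB = 1) by (rewrite <- M1', Q; ring).
  assert (mA * k > 0) by now apply Rmult_lt_0_compat.
  assert (0 < nB) by nra.
  assert ((mA * k) ^ 2 = mB ^ 2) by (apply (Rmult_eq_reg_r nB); lra).
  nra. }
unfold tangent_meet. cbv zeta. fold mA mB.
transitivity (lin mA (lin 1 (c a) (- rho c a b) (D c a)) 0 (c a)).
{ apply vec3_ext; unfold lin, x1, x2, x3; simpl; ring. }
rewrite E, <- G.
apply vec3_ext; unfold lin, x1, x2, x3; simpl; ring.
Qed.

Lemma plus_scal_lin a x b y : plus (scal a x) (scal b y) = lin a x b y.
Proof. reflexivity. Qed.

Lemma ball_vec3 (x y : vec3) (r : R) : ball x r y ->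
  Rabs (x1 y - x1 x) < r /\ Rabs (x2 y - x2 x) < r /\ Rabs (x3 y - x3 x) < r.
Proof. intros [[H1 H2] H3]; exact (conj H1 (conj H2 H3)). Qed.

(** The origin of the radius 1/2: if [x] and its antipode are both that close to [o], all
    coordinates of [o] are below 1/2 in absolute value, which no point of the three surfaces
    allows. *)
Lemma on_surface_opp_far g (o x : vec3) : on_surface g o ->
  ball o (1 / 2) x -> ball o (1 / 2) (lin (-1) x 0 x) -> False.
Proof.
intros H Hx Hy.
destruct (ball_vec3 _ _ _ Hx) as [A1 [A2 A3]]. destruct (ball_vec3 _ _ _ Hy) as [B1 [B2 B3]].
apply Rabs_def2 in A1, A2, A3, B1, B2, B3.
assert (x1 (lin (-1) x 0 x) = - x1 x) by (unfold lin, x1; simpl; ring).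
assert (x2 (lin (-1) x 0 x) = - x2 x) by (unfold lin, x2; simpl; ring).
assert (x3 (lin (-1) x 0 x) = - x3 x) by (unfold lin, x3; simpl; ring).
assert (C1 : x1 o ^ 2 < 1 / 4) by nra. assert (C2 : x2 o ^ 2 < 1 / 4) by nra.
assert (C3 : x3 o ^ 2 < 1 / 4) by nra.
destruct g; unfold on_surface in H.
- rewrite H in C3; lra.
- lra.
- assert (0 <= x1 o ^ 2) by apply pow2_ge_0. assert (0 <= x2 o ^ 2) by apply pow2_ge_0. lra.
Qed.

Lemma tangent_meet_intersection g c e lo hi o r a b : convex_arc g c e lo hi ->
  lo < a < hi -> lo < b < hi -> a <> b -> ball o r (tangent_meet g c a b) ->
  tangent_intersection g c o r a b (tangent_meet g c a b).
Proof.
intros HA Ha Hb Hab HB. split; [assumption|]. 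
assert (S : on_surface g (tangent_meet g c a b)).
{ rewrite (tangent_meet_geodesic_point _ _ _ _ _ _ _ HA Ha).
  apply geodesic_point_on_surface; [now apply (unit_velocity_frame _ _ e lo hi)|].
  replace ((- tau g c a b) ^ 2) with (tau g c a b ^ 2) by ring.
  now apply (tau_curvature _ _ e lo hi). }
split; (split; [assumption|]).
- eexists; eexists; rewrite plus_scal_lin; reflexivity.
- rewrite (tangent_meet_sym _ _ _ _ _ _ _ HA Ha Hb Hab).
  eexists; eexists; rewrite plus_scal_lin; reflexivity.
Qed.

(** The two planes share only a line, and a point of the surface on it is the meeting point or its
    antipode. The antipode is too far from [o]. *)
Lemma tangent_intersection_unique g c e lo hi o a b X : convex_arc g c e lo hi ->
  lo < a < hi -> lo < b < hi -> a <> b -> on_surface g o ->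
  ball o (1 / 2) (tangent_meet g c a b) ->
  tangent_intersection g c o (1 / 2) a b X -> X = tangent_meet g c a b.
Proof.
intros HA Ha Hb Hab Ho HB [HX [[SX [al [be EX]]] [_ [al' [be' EX']]]]].
rewrite plus_scal_lin in EX, EX'.
destruct (rho_bounds _ _ _ _ _ _ _ HA Ha Hb Hab) as [N1 _].
destruct (scale_pos _ _ _ _ _ _ _ HA Ha Hb Hab) as [M1 M1'].
assert (Z : be = - (al * rho c a b)).
{ assert (Q := f_equal (det (c b) (D c b)) (eq_trans (eq_sym EX) EX')).
  rewrite !det_lin_r in Q. destruct (det_diag (c b) (D c b)) as [Z1 [Z2 _]].
  rewrite Z1, Z2 in Q. unfold rho.
  apply (Rmult_eq_reg_r (det (c b) (D c b) (D c a))); [|assumption].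
  field_simplify; [lra | assumption]. }
assert (Q := surface_form_self g X SX).
rewrite EX, (tangent_form _ _ _ _ _ _ _ _ HA Ha), Z in Q.
set (m := scale g c a b) in *.
assert (al ^ 2 = m ^ 2).
{ unfold tau in M1'. set (n := 1 + _) in M1'. assert (al ^ 2 * n = 1) by (rewrite <- Q; unfold n; ring).
  assert (n <> 0) by (intros E; rewrite E in M1'; lra).
  apply (Rmult_eq_reg_r n); lra. }
assert (H' : (al - m) * (al + m) = 0) by lra.
apply Rmult_integral in H'. destruct H' as [H' | H'].
- rewrite EX, Z. replace al with m by lra. reflexivity.
- exfalso. apply (on_surface_opp_far g o (tangent_meet g c a b)); try assumption.
  replace (lin _ _ _ _) with X; [assumption|].
  rewrite EX, Z. replace al with (- m) by lra. unfold tangent_meet. fold m. cbv zeta.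
  apply vec3_ext; unfold lin, x1, x2, x3; simpl; ring.
Qed.

(** * The first variation of the string length *)

(** The minus sign in the second term makes its argument positive: for b < a the meeting point lies
    behind [c a] but ahead of [c b], and [tau g c b a] is negative. *)
Definition string_fun (g : geometry) (c : R -> vec3) (a b : R) : R :=
  arctan_K g (tau g c a b) + arctan_K g (- tau g c b a) - arc_length g c b a.

Lemma tau_sign g c e lo hi a b : convex_arc g c e lo hi ->
  lo < a < hi -> lo < b < hi -> b < a -> 0 < tau g c a b /\ tau g c b a < 0.
Proof.
intros HA Ha Hb Hab.
assert (N1 : a <> b) by lra. assert (N2 : b <> a) by lra.
destruct (rho_bounds _ _ _ _ _ _ _ HA Ha Hb N1) as [_ [P1 _]].
destruct (rho_bounds _ _ _ _ _ _ _ HA Hb Ha N2) as [_ [P2 _]].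
assert (S1 := speed_pos _ _ _ _ _ _ HA Ha). assert (S2 := speed_pos _ _ _ _ _ _ HA Hb).
unfold tau.
replace (rho c a b) with (rho c a b / (a - b) * (a - b)) by (field; lra).
replace (rho c b a) with (- (rho c b a / (b - a) * (a - b))) by (field; lra).
set (q1 := rho c a b / (a - b)) in *. set (q2 := rho c b a / (b - a)) in *.
assert (0 < q1 * (a - b)) by (apply Rmult_lt_0_compat; lra).
assert (0 < q2 * (a - b)) by (apply Rmult_lt_0_compat; lra).
split; [now apply Rmult_lt_0_compat|].
assert (0 < norm_Q g (D c b) * (q2 * (a - b))) by now apply Rmult_lt_0_compat. lra.
Qed.

Lemma string_L_tangent_meet g c e lo hi a b : convex_arc g c e lo hi ->
  lo < a < hi -> lo < b < hi -> b < a ->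
  string_L g c a b (tangent_meet g c a b) = string_fun g c a b.
Proof.
intros HA Ha Hb Hab.
assert (N1 : a <> b) by lra. assert (N2 : b <> a) by lra.
destruct (tau_sign _ _ _ _ _ _ _ HA Ha Hb Hab) as [T1 T2].
destruct (scale_pos _ _ _ _ _ _ _ HA Ha Hb N1) as [M1 M1'].
destruct (scale_pos _ _ _ _ _ _ _ HA Hb Ha N2) as [M2 M2'].
unfold string_L, string_fun. f_equal. f_equal.
(* The meeting point lies behind [c a], hence the reversed frame at [a] and the original one at
   [b]. *)
- rewrite <- (segment_length_frame g (c a) (lin (-1) (unit_velocity g c a) 0 (0, 0, 0))
    (scale g c a b)); try assumption; try lra.
  + f_equal. rewrite (tangent_meet_geodesic_point _ _ _ _ _ _ _ HA Ha).
    unfold geodesic_point.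
    replace ((- tau g c a b) ^ 2) with (tau g c a b ^ 2) by ring. fold (scale g c a b).
    apply vec3_ext; unfold lin, x1, x2, x3; simpl; ring.
  + now apply frame_opp, (unit_velocity_frame _ _ e lo hi).
- rewrite (tangent_meet_sym _ _ _ _ _ _ _ HA Ha Hb N1).
  rewrite <- (segment_length_frame g (c b) (unit_velocity g c b)
    (scale g c b a)); try assumption; try lra.
  + f_equal. rewrite (tangent_meet_geodesic_point _ _ _ _ _ _ _ HA Hb).
    unfold geodesic_point.
    replace ((- tau g c b a) ^ 2) with (tau g c b a ^ 2) by ring. fold (scale g c b a).
    reflexivity.
  + now apply (unit_velocity_frame _ _ e lo hi).
Qed.

Lemma ex_RInt_between (f : R -> R) lo hi a b :
  (forall s, lo < s < hi -> continuous f s) -> lo < a < hi -> lo < b < hi ->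
  ex_RInt f a b.
Proof.
intros Hf Ha Hb. apply (ex_RInt_continuous (V := R_CompleteNormedModule)).
intros z Hz. apply Hf. unfold Rmin, Rmax in Hz. destruct (Rle_dec a b); lra.
Qed.

Lemma is_derive_primitive (f : R -> R) lo hi a s :
  (forall s, lo < s < hi -> continuous f s) -> lo < a < hi -> lo < s < hi ->
  is_derive (fun u => RInt f a u) s (f s).
Proof.
intros Hf Ha Hs. apply (is_derive_RInt f _ a s); [|now apply Hf].
apply (filter_imp (fun u => lo < u < hi)); [|now apply locally_between].
intros u Hu. apply (RInt_correct f a u). now apply (ex_RInt_between f lo hi).
Qed.

Lemma is_derive_locally_between (p : R -> R) u dp lo hi :
  is_derive p u dp -> lo < p u < hi -> locally u (fun x => lo < p x < hi).
Proof.
intros Dp H.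
assert (C := ex_derive_continuous (V := R_NormedModule) p u (ex_intro _ dp Dp)).
exact (C _ (locally_between _ _ _ H)).
Qed.

Lemma ex_derive_speed g c e lo hi s : convex_arc g c e lo hi -> lo < s < hi ->
  ex_derive (fun s => norm_Q g (D c s)) s.
Proof.
intros HA Hs. assert (Dw := arc_acceleration _ _ _ _ _ HA s Hs).
eexists. unfold norm_Q.
apply (is_derive_comp sqrt (fun s => metric g (D c s) (D c s))).
- apply is_derive_Reals, derivable_pt_lim_sqrt. now apply (arc_regular _ _ _ _ _ HA).
- apply der3_metric; eassumption.
Qed.

Lemma is_derive_arc_length g c e lo hi p q u dp dq : convex_arc g c e lo hi ->
  lo < p u < hi -> lo < q u < hi -> is_derive p u dp -> is_derive q u dq ->
  is_derive (fun x => arc_length g c (q x) (p x)) u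
    (norm_Q g (D c (p u)) * dp - norm_Q g (D c (q u)) * dq).
Proof.
intros HA Hp Hq Dp Dq.
assert (Cs : forall s, lo < s < hi -> continuous (fun s => norm_Q g (D c s)) s).
{ intros s Hs. apply (ex_derive_continuous (V := R_NormedModule)).
  now apply (ex_derive_speed g c e lo hi). }
set (f := fun s => norm_Q g (D c s)) in *.
apply is_derive_ext_loc with (fun x => RInt f (p u) (p x) - RInt f (p u) (q x)).
{ assert (Lp := is_derive_locally_between _ _ _ _ _ Dp Hp).
  assert (Lq := is_derive_locally_between _ _ _ _ _ Dq Hq).
  apply (filter_imp (fun x => (lo < p x < hi) /\ (lo < q x < hi)));
    [|now apply filter_and]. intros x [Hpx Hqx].
  unfold arc_length. fold f.
  assert (E := RInt_Chasles f (p u) (q x) (p x) (ex_RInt_between f lo hi _ _ Cs Hp Hqx)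
    (ex_RInt_between f lo hi _ _ Cs Hqx Hpx)).
  change (RInt f (p u) (q x) + RInt f (q x) (p x) = RInt f (p u) (p x)) in E. lra. }
evar_last.
{ apply derive_minus.
  - apply (is_derive_comp (fun y => RInt f (p u) y) p); [|exact Dp].
    now apply (is_derive_primitive f lo hi).
  - apply (is_derive_comp (fun y => RInt f (p u) y) q); [|exact Dq].
    now apply (is_derive_primitive f lo hi). }
unfold scal; simpl; unfold mult; simpl. fold (f (p u)) (f (q u)). ring.
Qed.

(** Differentiating the frame relations <Qv,v> = 1 and <Pc,v> = 0 gives the hypotheses of
    [frame_decomp]. The last value is the signed geodesic curvature times the speed. *)
Lemma unit_velocity_derive g c e lo hi s : convex_arc g c e lo hi -> lo < s < hi ->
  exists dv, der3 (unit_velocity g c) s dv /\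
    metric g (unit_velocity g c s) dv = 0 /\
    surface_form g (c s) dv = - Gauss_curvature g * norm_Q g (D c s) /\
    det (c s) (unit_velocity g c s) dv =
      det (c s) (D c s) (D (D c) s) / norm_Q g (D c s) ^ 2.
Proof.
intros HA Hs.
assert (Dc := arc_velocity _ _ _ _ _ HA s Hs).
assert (Dw := arc_acceleration _ _ _ _ _ HA s Hs).
assert (P := speed_pos _ _ _ _ _ _ HA Hs).
destruct (ex_derive_speed _ _ _ _ _ _ HA Hs) as [ds Ds].
assert (Di := is_derive_inv _ _ _ Ds (Rgt_not_eq _ _ P)).
assert (Dv := der3_lin _ _ (D c) (fun _ => (0, 0, 0)) s _ _ _ _ Di (derive_const 0 s)
  Dw (der3_const (0, 0, 0) s)).
set (k := - ds / _) in Dv. clearbody k. cbv beta in Dv.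
match type of Dv with der3 _ _ ?d => exists d; set (dv := d) in * end.
change (der3 (unit_velocity g c) s dv) in Dv.
split; [assumption|].
assert (L : locally s (fun u => lo < u < hi)) by now apply locally_between.
split; [|split].
- assert (E := is_derive_locally_const _ s _ 1 (der3_metric g _ _ _ _ _ Dv Dv)).
  rewrite (metric_sym g dv) in E.
  enough (metric g (unit_velocity g c s) dv + metric g (unit_velocity g c s) dv = 0) by lra.
  apply E. apply (filter_imp _ _ (fun u Hu => proj2 (proj2 (unit_velocity_frame _ _ _ _ _ u HA Hu))) L).
- assert (E := is_derive_locally_const _ s _ 0 (der3_surface_form g _ _ _ _ _ Dc Dv)).
  destruct (unit_velocity_frame _ _ _ _ _ s HA Hs) as [F1 [F2 F3]].
  enough (T : surface_form g (D c s) (unit_velocity g c s) + surface_form g (c s) dv = 0).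
  { rewrite (velocity_lin _ _ _ _ _ _ HA Hs) in T.
    assert (T' : surface_form g (lin (norm_Q g (D c s)) (unit_velocity g c s) 0 (0, 0, 0))
      (unit_velocity g c s) = norm_Q g (D c s) * (Gauss_curvature g * 1)).
    { rewrite <- F3, <- (surface_form_tangent g _ _ F1 F2).
      unfold surface_form, lin, x1, x2, x3; simpl; ring. }
    rewrite T' in T. lra. }
  apply E. apply (filter_imp _ _ (fun u Hu => proj1 (proj2 (unit_velocity_frame _ _ _ _ _ u HA Hu))) L).
- unfold dv, unit_velocity. 
  set (n := norm_Q g (D c s)) in *; clearbody n. clear Dv dv.
  generalize (c s) (D c s) (D (D c) s). intros x w z.
  coords. field. lra.
Qed.

(** Existence is enough here: the value of the derivative is determined by the implicit equation
    [tau_equation]. *)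
Lemma ex_derive_tau g c e lo hi p q u dp dq : convex_arc g c e lo hi ->
  lo < p u < hi -> lo < q u < hi -> p u <> q u ->
  is_derive p u dp -> is_derive q u dq ->
  ex_derive (fun x => tau g c (p x) (q x)) u.
Proof.
intros HA Hp Hq Hpq Dp Dq.
destruct (rho_bounds _ _ _ _ _ _ _ HA Hp Hq Hpq) as [N _].
assert (Cp := der3_comp c p u _ _ (arc_velocity _ _ _ _ _ HA _ Hp) Dp).
assert (Cq := der3_comp c q u _ _ (arc_velocity _ _ _ _ _ HA _ Hq) Dq).
assert (Wp := der3_comp (D c) p u _ _ (arc_acceleration _ _ _ _ _ HA _ Hp) Dp).
assert (Wq := der3_comp (D c) q u _ _ (arc_acceleration _ _ _ _ _ HA _ Hq) Dq).
destruct (ex_derive_speed _ _ _ _ _ _ HA Hp) as [ds Ds].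
eexists. unfold tau, rho. apply derive_mult.
- apply (is_derive_comp (fun s => norm_Q g (D c s)) p); eassumption.
- apply is_derive_div; [| |exact N].
  + exact (der3_det _ _ _ _ _ _ _ Cq Wq Cp).
  + exact (der3_det _ _ _ _ _ _ _ Cq Wq Wp).
Qed.

Lemma tau_det_zero g c e lo hi s o : convex_arc g c e lo hi ->
  lo < s < hi -> lo < o < hi -> s <> o ->
  det (c o) (unit_velocity g c o) (lin 1 (c s) (- tau g c s o) (unit_velocity g c s)) = 0.
Proof.
intros HA Hs Ho Hso.
destruct (rho_bounds _ _ _ _ _ _ _ HA Hs Ho Hso) as [N _].
assert (S1 := speed_pos _ _ _ _ _ _ HA Hs). assert (S2 := speed_pos _ _ _ _ _ _ HA Ho).
replace (lin 1 (c s) (- tau g c s o) (unit_velocity g c s))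
  with (lin 1 (c s) (- rho c s o) (D c s)).
- unfold unit_velocity. rewrite det_lin_r, !det_lin_m.
  unfold rho. set (d0 := det (c o) (D c o) (c s)) in *. set (d1 := det (c o) (D c o) (D c s)) in *.
  field. lra.
- unfold tau, unit_velocity. set (n := norm_Q g (D c s)) in *. clearbody n.
  generalize (rho c s o) (c s) (D c s). intros r x w.
  apply vec3_ext; coords; field; lra.
Qed.

Lemma unit_velocity_det g c e lo hi s o : convex_arc g c e lo hi ->
  lo < s < hi -> lo < o < hi ->
  det (c o) (unit_velocity g c o) (unit_velocity g c s) =
  det (c o) (D c o) (D c s) / (norm_Q g (D c o) * norm_Q g (D c s)).
Proof.
intros HA Hs Ho.
assert (S1 := speed_pos _ _ _ _ _ _ HA Hs). assert (S2 := speed_pos _ _ _ _ _ _ HA Ho).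
unfold unit_velocity. rewrite det_lin_r, !det_lin_m.
replace (det (c o) (0, 0, 0) (D c s)) with 0 by (unfold det, dot, cross, x1, x2, x3; simpl; ring).
replace (det (c o) (D c o) (0, 0, 0)) with 0 by (unfold det, dot, cross, x1, x2, x3; simpl; ring).
replace (det (c o) (0, 0, 0) (0, 0, 0)) with 0 by (unfold det, dot, cross, x1, x2, x3; simpl; ring).
field; lra.
Qed.

(** The derivative of [tau_det_zero] along a path of pairs. The motion of B drops out of the first
    slot of the determinant because it is parallel to [w]. *)
Lemma tau_equation g c e lo hi p q u dp dq dt V U : convex_arc g c e lo hi ->
  lo < p u < hi -> lo < q u < hi -> p u <> q u ->
  is_derive p u dp -> is_derive q u dq ->
  is_derive (fun x => tau g c (p x) (q x)) u dt ->
  der3 (fun x => unit_velocity g c (p x)) u V ->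
  der3 (fun x => unit_velocity g c (q x)) u U ->
  let A := c (p u) in let B := c (q u) in
  let v := unit_velocity g c (p u) in let w := unit_velocity g c (q u) in
  let t := tau g c (p u) (q u) in
  det B U (lin 1 A (- t) v) +
  det B w (lin (norm_Q g (D c (p u)) * dp - dt) v (- t) V) = 0.
Proof.
intros HA Hp Hq Hpq Dp Dq Dt DV DU A B v w t.
assert (Cp := der3_comp c p u _ _ (arc_velocity _ _ _ _ _ HA _ Hp) Dp).
assert (Cq := der3_comp c q u _ _ (arc_velocity _ _ _ _ _ HA _ Hq) Dq).
assert (DL := der3_lin (fun _ => 1) (fun x => 0 - tau g c (p x) (q x)) _ _ u _ _ _ _
  (derive_const 1 u) (derive_minus _ _ _ _ _ (derive_const 0 u) Dt) Cp DV).
assert (E := is_derive_locally_const _ u _ 0 (der3_det _ _ _ _ _ _ _ Cq DU DL)).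
cbv beta in E. fold A B v w t in E.
rewrite <- E; clear E.
- rewrite (velocity_lin _ _ _ _ _ _ HA Hq) at 1 2.
  rewrite (velocity_lin _ _ _ _ _ _ HA Hp) at 2 3.
  fold v w.
  set (n := norm_Q g (D c (p u))). set (k := norm_Q g (D c (q u))).
  clearbody n k A B v w t. clear - n.
  coords. ring.
- assert (Lp := is_derive_locally_between _ _ _ _ _ Dp Hp).
  assert (Lq := is_derive_locally_between _ _ _ _ _ Dq Hq).
  assert (Ln : locally u (fun x => p x - q x <> 0)).
  { assert (C := ex_derive_continuous (V := R_NormedModule) (fun x => p x - q x) u
      (ex_intro _ _ (derive_minus _ _ _ _ _ Dp Dq))).
    apply (C (fun y => y <> 0)). apply (open_neq 0). lra. }
  apply (filter_imp (fun x => (lo < p x < hi) /\ (lo < q x < hi) /\ p x - q x <> 0));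
    [|exact (filter_and _ _ Lp (filter_and _ _ Lq Ln))]. intros x [Hpx [Hqx Hx]].
  replace (0 - tau g c (p x) (q x)) with (- tau g c (p x) (q x)) by ring.
  apply (tau_det_zero _ _ _ _ _ _ _ HA); lra.
Qed.

(** The relation cos^2 + sin^2 = 1 for the angle between the geodesics, obtained by expanding the
    unit covector [cross B u] in the frame at A. At a meeting point with det B u A = tA * det B u v,
    the first two terms add up to det B u v ^ 2 * (1 + K tA^2), the squared sine. *)
Lemma normal_angle g A v B u : frame g A v -> frame g B u ->
  Gauss_curvature g * det B u A ^ 2 + det B u v ^ 2 + det A v (normal g B u) ^ 2 = 1.
Proof.
intros FA FB.
assert (C := frame_completeness g A v (cross B u) FA).
replace (metric g (cross B u) (cross B u)) with (det B u (normal g B u)) in C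
  by (unfold metric, det, normal; generalize (cross B u); intros n; unfold dot; ring).
rewrite (det_normal g B u FB) in C.
rewrite (det_normal_sym g A v B u).
rewrite C; unfold det. 
replace (metric g (cross B u) (cross A v)) with (dot (cross B u) (normal g A v))
  by (rewrite metric_sym; unfold metric, normal; generalize (cross B u) (cross A v);
      intros n k; unfold dot; ring).
reflexivity.
Qed.

(** The first variation formula of the overview: [F] is (1 - cos theta) / sin theta = tan (theta /
    2), with the sign [e] moved into [omega], and omega / speed^2 is the unsigned curvature times
    the speed. *)
Lemma string_fun_derive g c e lo hi p q u dp dq : convex_arc g c e lo hi ->
  lo < p u < hi -> lo < q u < hi -> q u < p u ->
  is_derive p u dp -> is_derive q u dq ->
  let a := p u in let b := q u in
  let omega s := e * det (c s) (D c s) (D (D c) s) in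
  exists F, 0 < F /\
    is_derive (fun x => string_fun g c (p x) (q x)) u
      (F * (dp * omega a / norm_Q g (D c a) ^ 2 * (tau g c a b * scale g c a b) -
            dq * omega b / norm_Q g (D c b) ^ 2 * (- tau g c b a * scale g c b a))).
Proof.
intros HA Hp Hq Hqp Dp Dq a b omega.
assert (N1 : p u <> q u) by lra. assert (N2 : q u <> p u) by lra.
destruct (ex_derive_tau _ _ _ _ _ _ _ _ _ _ HA Hp Hq N1 Dp Dq) as [dA DA].
destruct (ex_derive_tau _ _ _ _ _ _ _ _ _ _ HA Hq Hp N2 Dq Dp) as [dB DB].
destruct (unit_velocity_derive _ _ _ _ _ _ HA Hp) as [V0 [DV0 [V1 [V2 V3]]]].
destruct (unit_velocity_derive _ _ _ _ _ _ HA Hq) as [U0 [DU0 [U1 [U2 U3]]]].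
assert (DV := der3_comp _ _ _ _ _ DV0 Dp). assert (DU := der3_comp _ _ _ _ _ DU0 Dq).
set (V := lin dp V0 0 V0) in *. set (U := lin dq U0 0 U0) in *.
assert (EA := tau_equation _ _ _ _ _ _ _ _ _ _ _ _ _ HA Hp Hq N1 Dp Dq DA DV DU).
assert (EB := tau_equation _ _ _ _ _ _ _ _ _ _ _ _ _ HA Hq Hp N2 Dq Dp DB DU DV).
cbv zeta in EA, EB. repeat match goal with H : _ |- _ => progress fold a b in H end.
assert (FA := unit_velocity_frame _ _ _ _ _ _ HA Hp).
assert (FB := unit_velocity_frame _ _ _ _ _ _ HA Hq).
destruct (scale_pos _ _ _ _ _ _ _ HA Hp Hq N1) as [M1 M1'].
destruct (scale_pos _ _ _ _ _ _ _ HA Hq Hp N2) as [M2 M2'].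
destruct (arc_contact _ _ _ _ _ _ _ HA Hp Hq N1) as [_ [P1 _]].
assert (S1 := speed_pos _ _ _ _ _ _ HA Hp). assert (S2 := speed_pos _ _ _ _ _ _ HA Hq).
assert (K1 := tau_curvature _ _ _ _ _ _ _ HA Hp Hq N1).
assert (K2 := tau_curvature _ _ _ _ _ _ _ HA Hq Hp N2).
assert (Ed := unit_velocity_det _ _ _ _ _ _ _ HA Hp Hq).
assert (EX := tangent_meet_sym _ _ _ _ _ _ _ HA Hp Hq N1).
rewrite (tangent_meet_geodesic_point _ _ _ _ _ _ _ HA Hp),
  (tangent_meet_geodesic_point _ _ _ _ _ _ _ HA Hq) in EX.
unfold geodesic_point in EX.
assert (Z := tau_det_zero _ _ _ _ _ _ _ HA Hp Hq N1).
repeat match goal with H : _ |- _ => progress fold a b in H end.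
replace ((- tau g c a b) ^ 2) with (tau g c a b ^ 2) in EX by ring.
replace ((- tau g c b a) ^ 2) with (tau g c b a ^ 2) in EX by ring.
cbv zeta in EX. fold (scale g c a b) (scale g c b a) in EX.
set (v := unit_velocity g c a) in *. set (w := unit_velocity g c b) in *.
set (A := c a) in *. set (B := c b) in *.
set (tA := tau g c a b) in *. set (mA := scale g c a b) in *.
set (mB := scale g c b a) in *.
set (nA := norm_Q g (D c a)) in *. set (nB := norm_Q g (D c b)) in *.
assert (Pd : 0 < e * det B w v).
{ rewrite Ed.
  replace (e * (_ / _)) with ((a - b) * (e * det B (D c b) (D c a)) / ((a - b) * (nB * nA)))
    by (field; repeat split; lra).
  apply Rdiv_lt_0_compat; [assumption|].
  apply Rmult_lt_0_compat; [lra | now apply Rmult_lt_0_compat]. }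
assert (e <> 0) by (intros E; rewrite E in Pd; lra).
assert (e2 := arc_sign _ _ _ _ _ HA).
assert (Hd : det B w v <> 0) by (intros E; rewrite E in Pd; lra).
(* The geodesics cross at a nonzero angle, so the cosine is below 1 and [F] is positive. *)
assert (HT : det A v (normal g B w) < 1).
{ assert (Y := normal_angle g A v B w FA FB).
  rewrite det_lin_r in Z. replace (det B w A) with (tA * det B w v) in Y by lra.
  assert (0 < det B w v ^ 2 * (1 + Gauss_curvature g * tA ^ 2)).
  { apply Rmult_lt_0_compat; [|assumption]. apply pow2_gt_0; assumption. }
  nra. }
exists ((1 - det A v (normal g B w)) * mA / (e * det B w v)).
split.
{ apply Rdiv_lt_0_compat; [|assumption]. apply Rmult_lt_0_compat; lra. }
(* At B the distance is counted forwards, so [tB] is - tau g c b a and its derivative is - dB. *)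
assert (Main := string_variation g A v B w V U tA (- tau g c b a) mA mB (dp * nA) (dq * nB)
  dA (- dB) FA FB).
cbv zeta in Main.
assert (HV3 : det A v V = dp * (det A (D c a) (D (D c) a) / nA ^ 2)).
{ unfold V. rewrite det_lin_r, V3. ring. }
assert (HU3 : det B w U = dq * (det B (D c b) (D (D c) b) / nB ^ 2)).
{ unfold U. rewrite det_lin_r, U3. ring. }
evar_last.
{ unfold string_fun. apply derive_minus; [apply derive_plus|].
  - apply (is_derive_comp (arctan_K g) (fun x => tau g c (p x) (q x))); [|exact DA].
    apply is_derive_arctan_K. exact K1.
  - apply (is_derive_comp (arctan_K g) (fun x => - tau g c (q x) (p x))).
    + apply is_derive_arctan_K. fold a b.
      replace ((- tau g c b a) ^ 2) with (tau g c b a ^ 2) by ring. exact K2.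
    + apply (is_derive_opp (fun x => tau g c (q x) (p x))). exact DB.
  - exact (is_derive_arc_length g c e lo hi p q u dp dq HA Hp Hq Dp Dq). }
fold a b. fold nA nB tA.
change (dA * / (1 + Gauss_curvature g * tA ^ 2) +
  - dB * / (1 + Gauss_curvature g * (- tau g c b a) ^ 2) - (nA * dp - nB * dq) =
  (1 - det A v (normal g B w)) * mA / (e * det B w v) *
   (dp * omega a / nA ^ 2 * (tA * mA) - dq * omega b / nB ^ 2 * (- tau g c b a * mB))).
transitivity (dA / (1 + Gauss_curvature g * tA ^ 2) +
  - dB / (1 + Gauss_curvature g * (- tau g c b a) ^ 2) - (dp * nA - dq * nB));
  [unfold Rdiv; ring|].
rewrite Main.
- rewrite HV3, HU3. unfold omega. fold A B. field; lra.
- transitivity (dp * surface_form g A V0); [unfold surface_form, V, lin, x1, x2, x3; simpl; ring|].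
  rewrite V2. ring.
- transitivity (dp * metric g v V0); [rewrite !metricE; unfold V, lin, x1, x2, x3; simpl; ring|].
  rewrite V1. ring.
- transitivity (dq * surface_form g B U0); [unfold surface_form, U, lin, x1, x2, x3; simpl; ring|].
  rewrite U2. ring.
- transitivity (dq * metric g w U0); [rewrite !metricE; unfold U, lin, x1, x2, x3; simpl; ring|].
  rewrite U1. ring.
- replace (- (mA * tA)) with (mA * - tA) by ring. exact EX.
- exact M1'.
- eapply eq_trans; [|exact M2']. ring.
- replace (dp * nA - dA) with (nA * dp - dA) by ring. exact EA.
- replace (dq * nB + - dB) with (nB * dq - dB) by ring. exact EB.
- exact Hd.
Qed.

(** * Arcs of conics *)

Definition conic_form (M : @matrix R 3 3) (x y : vec3) : R := dot (apply_mx M x) y.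

Lemma conic_form_sym M x y : symmetric_mx M -> conic_form M x y = conic_form M y x.
Proof.
intros S.
assert (E1 := S 0%nat 1%nat ltac:(auto) ltac:(auto)).
assert (E2 := S 0%nat 2%nat ltac:(auto) ltac:(auto)).
assert (E3 := S 1%nat 2%nat ltac:(auto) ltac:(auto)).
unfold conic_form, dot, apply_mx. rewrite E1, E2, E3.
unfold x1, x2, x3; cbn [fst snd]; ring.
Qed.

Lemma conic_form_lin M p x q y z :
  conic_form M (lin p x q y) z = p * conic_form M x z + q * conic_form M y z.
Proof. unfold conic_form, dot, apply_mx, lin, x1, x2, x3; cbn [fst snd]; ring. Qed.

Lemma conic_form_lin_self M p x q y : symmetric_mx M ->
  conic_form M (lin p x q y) (lin p x q y) =
  p ^ 2 * conic_form M x x + 2 * p * q * conic_form M x y + q ^ 2 * conic_form M y y.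
Proof.
intros S. rewrite conic_form_lin, !(conic_form_sym M _ (lin p x q y) S), !conic_form_lin.
rewrite (conic_form_sym M y x S). ring.
Qed.

Lemma matrix_eq_zero (M : @matrix R 3 3) :
  (forall x y, conic_form M x y = 0) -> M = zero.
Proof.
intros H.
assert (H1 := fun y => H (1, 0, 0) y). assert (H2 := fun y => H (0, 1, 0) y).
assert (H3 := fun y => H (0, 0, 1) y).
assert (H11 := H1 (1, 0, 0)). assert (H12 := H1 (0, 1, 0)). assert (H13 := H1 (0, 0, 1)).
assert (H21 := H2 (1, 0, 0)). assert (H22 := H2 (0, 1, 0)). assert (H23 := H2 (0, 0, 1)).
assert (H31 := H3 (1, 0, 0)). assert (H32 := H3 (0, 1, 0)). assert (H33 := H3 (0, 0, 1)).
clear H H1 H2 H3.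
destruct M as [[a11 [a12 [a13 []]]] [[a21 [a22 [a23 []]]] [[a31 [a32 [a33 []]]] []]]].
unfold conic_form, dot, apply_mx, x1, x2, x3, coeff_mat in *; simpl in *.
replace a11 with 0 by lra; replace a12 with 0 by lra; replace a13 with 0 by lra.
replace a21 with 0 by lra; replace a22 with 0 by lra; replace a23 with 0 by lra.
replace a31 with 0 by lra; replace a32 with 0 by lra; replace a33 with 0 by lra.
reflexivity.
Qed.

Lemma cramer x w z y :
  lin (det x w z) y 0 y =
  lin 1 (lin (det y w z) x (det x y z) w) (det x w y) z.
Proof. apply vec3_ext; coords; ring. Qed.

Lemma conic_tangent g M c e lo hi s : symmetric_mx M -> convex_arc g c e lo hi ->
  (forall u, lo < u < hi -> conic_form M (c u) (c u) = 0) -> lo < s < hi ->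
  conic_form M (c s) (D c s) = 0.
Proof.
intros S HA HC Hs.
assert (Dc := arc_velocity _ _ _ _ _ HA s Hs).
assert (E := is_derive_locally_const _ s _ 0 (der3_quadratic M _ _ _ _ _ Dc Dc)).
fold (conic_form M (D c s) (c s)) (conic_form M (c s) (D c s)) in E.
rewrite (conic_form_sym M (D c s) (c s) S) in E.
enough (conic_form M (c s) (D c s) + conic_form M (c s) (D c s) = 0) by lra.
apply E. apply (filter_imp (fun u => lo < u < hi)); [exact HC | now apply locally_between].
Qed.

Lemma conic_acceleration g M c e lo hi s : symmetric_mx M -> convex_arc g c e lo hi ->
  (forall u, lo < u < hi -> conic_form M (c u) (c u) = 0) -> lo < s < hi ->
  conic_form M (c s) (D (D c) s) = - conic_form M (D c s) (D c s).
Proof.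
intros S HA HC Hs.
assert (Dc := arc_velocity _ _ _ _ _ HA s Hs).
assert (Dw := arc_acceleration _ _ _ _ _ HA s Hs).
assert (E := is_derive_locally_const _ s _ 0 (der3_quadratic M _ _ _ _ _ Dc Dw)).
fold (conic_form M (D c s) (D c s)) (conic_form M (c s) (D (D c) s)) in E.
enough (conic_form M (D c s) (D c s) + conic_form M (c s) (D (D c) s) = 0) by lra.
apply E. apply (filter_imp (fun u => lo < u < hi)); [|now apply locally_between].
intros u Hu. now apply (conic_tangent g M c e lo hi).
Qed.

(** If <Cw,w> = 0 then C is orthogonal to A on the basis A, w, z of position, velocity and
    acceleration, so A is the vertex. In this basis the form factors into two planes, one of them
    the tangent plane at A. By strict convexity the curve leaves the tangent plane at once, so it
    lies in the other plane. That plane would then contain w, which kills <Cw,z>, and after that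
    <Cz,z>. *)
Lemma conic_velocity_neq0 g M c e lo hi s : symmetric_mx M -> M <> zero ->
  convex_arc g c e lo hi ->
  (forall u, lo < u < hi -> conic_form M (c u) (c u) = 0) -> lo < s < hi ->
  conic_form M (D c s) (D c s) <> 0.
Proof.
intros S NZ HA HC Hs Q22.
assert (Q11 := HC s Hs).
assert (Q12 := conic_tangent _ _ _ _ _ _ _ S HA HC Hs).
assert (Q13 := conic_acceleration _ _ _ _ _ _ _ S HA HC Hs).
rewrite Q22, Ropp_0 in Q13.
assert (PD := arc_convex _ _ _ _ _ HA s s Hs Hs).
set (A := c s) in *. set (w := D c s) in *. set (z := D (D c) s) in *.
set (d := det A w z) in *.
assert (Nd : d <> 0) by (intros E; rewrite E in PD; lra).
assert (Expand : forall y, d ^ 2 * conic_form M y y =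
  det A w y * (2 * det A y z * conic_form M w z + det A w y * conic_form M z z)).
{ intros y. transitivity (conic_form M (lin d y 0 y) (lin d y 0 y)).
  - rewrite conic_form_lin_self by assumption. ring.
  - unfold d. rewrite cramer.
    rewrite !conic_form_lin_self, conic_form_lin by assumption.
    rewrite Q11, Q12, Q13, Q22. ring. }
assert (G0 : forall u, lo < u < hi -> u <> s ->
  2 * det A (c u) z * conic_form M w z + det A w (c u) * conic_form M z z = 0).
{ intros u Hu Hus.
  destruct (arc_contact _ _ _ _ _ _ _ HA Hu Hs Hus) as [P _]. fold A w in P.
  assert (X := Expand (c u)). rewrite (HC u Hu), Rmult_0_r in X.
  symmetry in X. apply Rmult_integral in X. destruct X as [X | X]; [|exact X].
  rewrite X in P; lra. }
assert (Q23 : conic_form M w z = 0).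
{ assert (Dc := arc_velocity _ _ _ _ _ HA s Hs).
  assert (DG := derive_plus _ _ s _ _
    (derive_mult _ _ s _ _ (derive_mult _ _ s _ _ (derive_const 2 s)
      (der3_det _ _ _ s _ _ _ (der3_const A s) Dc (der3_const z s)))
      (derive_const (conic_form M w z) s))
    (derive_mult _ _ s _ _ (der3_det _ _ _ s _ _ _ (der3_const A s) (der3_const w s) Dc)
      (derive_const (conic_form M z z) s))).
  apply is_derive_locally_const with (k := 0) in DG.
  - cbv beta in DG. fold A w in DG.
    assert (E : 2 * (d * conic_form M w z) = 0).
    { rewrite <- DG. unfold d. clearbody A w z. clear.
      generalize (conic_form M w z) (conic_form M z z). intros r q. coords. ring. }
    destruct (Rmult_integral _ _ E) as [?|E']; [lra|].
    destruct (Rmult_integral _ _ E'); [contradiction | assumption].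
  - apply (filter_imp (fun u => lo < u < hi)); [|now apply locally_between].
    intros u Hu. destruct (Req_dec u s) as [->|N]; [|now apply G0].
    fold A. destruct (det_diag A z) as [_ [_ Z1]]. destruct (det_diag A w) as [Z2 _].
    match goal with |- @eq _ ?l ?r => change (@eq R l r) end. rewrite Z1, Z2. ring. }
assert (Q33 : conic_form M z z = 0).
(* Any parameter other than [s] would do: there det A w (c u) is nonzero. *)
{ set (u := (s + hi) / 2). assert (Hu : lo < u < hi) by (unfold u; lra).
  assert (N : u <> s) by (unfold u; lra).
  assert (X := G0 u Hu N). rewrite Q23, Rmult_0_r, Rplus_0_l in X.
  destruct (arc_contact _ _ _ _ _ _ _ HA Hu Hs N) as [P _]. fold A w in P.
  apply Rmult_integral in X. destruct X as [X | X]; [|exact X]. rewrite X in P; lra. }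
apply NZ, matrix_eq_zero.
assert (Z : forall y, conic_form M y y = 0).
{ intros y. assert (X := Expand y). rewrite Q23, Q33 in X.
  assert (d ^ 2 <> 0) by (apply pow_nonzero; assumption).
  apply (Rmult_eq_reg_l (d ^ 2)); [|assumption]. rewrite X; ring. }
(* Polarization. *)
intros x y. assert (X := Z (lin 1 x 1 y)).
rewrite conic_form_lin_self, !Z in X by assumption. lra.
Qed.

(* Both sides equal [|<C X, X>|^(1/2)] at the point [X] where the tangents meet,
   since [C]-orthogonality kills the other terms. *)
Lemma conic_tangent_balance g M c e lo hi a b : symmetric_mx M -> convex_arc g c e lo hi ->
  (forall u, lo < u < hi -> conic_form M (c u) (c u) = 0) ->
  lo < a < hi -> lo < b < hi -> b < a ->
  let f s := sqrt (Rabs (conic_form M (D c s) (D c s))) / norm_Q g (D c s) in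
  f a * (tau g c a b * scale g c a b) = f b * (- tau g c b a * scale g c b a).
Proof.
intros S HA HC Ha Hb Hab f.
assert (N1 : a <> b) by lra. assert (N2 : b <> a) by lra.
assert (V : forall s o, lo < s < hi -> Rabs (conic_form M (tangent_meet g c s o) (tangent_meet g c s o)) =
  (f s * (tau g c s o * scale g c s o)) ^ 2).
{ intros s o Hs. unfold tangent_meet. cbv zeta. rewrite conic_form_lin_self by assumption.
  rewrite (HC s Hs), (conic_tangent g M c e lo hi s S HA HC Hs).
  set (Q := conic_form M (D c s) (D c s)).
  unfold f. fold Q. rewrite !Rpow_mult_distr. unfold Rdiv. rewrite Rpow_mult_distr.
  rewrite pow2_sqrt by apply Rabs_pos. unfold tau. 
  assert (P := speed_pos _ _ _ _ _ _ HA Hs).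
  set (m := scale g c s o). set (r := rho c s o).
  replace (m ^ 2 * 0 + 2 * m * - (m * r) * 0 + (- (m * r)) ^ 2 * Q) with ((m * r) ^ 2 * Q) by ring.
  rewrite Rabs_mult, (Rabs_pos_eq ((m * r) ^ 2)) by apply pow2_ge_0.
  field. lra. }
assert (V1 := V a b Ha). assert (V2 := V b a Hb).
rewrite (tangent_meet_sym _ _ _ _ _ _ _ HA Ha Hb N1), V2 in V1.
destruct (tau_sign _ _ _ _ _ _ _ HA Ha Hb Hab) as [T1 T2].
destruct (scale_pos _ _ _ _ _ _ _ HA Ha Hb N1) as [M1 _].
destruct (scale_pos _ _ _ _ _ _ _ HA Hb Ha N2) as [M2 _].
assert (F : forall s, lo < s < hi -> 0 <= f s).
{ intros s Hs. apply Rmult_le_pos; [apply sqrt_pos|].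
  apply Rlt_le, Rinv_0_lt_compat. apply (speed_pos _ _ _ _ _ _ HA Hs). }
rewrite <- (sqrt_pow2 (f a * _)).
2: { apply Rmult_le_pos; [auto|]. apply Rlt_le, Rmult_lt_0_compat; lra. }
rewrite <- V1.
replace ((f b * (tau g c b a * scale g c b a)) ^ 2)
  with ((f b * (- tau g c b a * scale g c b a)) ^ 2) by ring.
apply sqrt_pow2. apply Rmult_le_pos; [auto|]. apply Rlt_le, Rmult_lt_0_compat; lra.
Qed.

(** * Functions of a difference *)

Lemma increasing_derive (t h : R -> R) lo hi :
  (forall s, lo < s < hi -> is_derive t s (h s)) ->
  (forall s, lo < s < hi -> 0 < h s) ->
  forall x y, lo < x -> x < y -> y < hi -> t x < t y.
Proof.
intros Dt Ph x y Hx Hxy Hy.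
destruct (MVT_cor2 t h x y Hxy) as [z [E Hz]].
{ intros; apply is_derive_Reals, Dt; lra. }
assert (0 < h z) by (apply Ph; lra). nra.
Qed.

(** The inverse is built over a compact subinterval, since nothing is assumed about [t] at [lo] and
    [hi]. *)
Lemma inverse_derive (t h : R -> R) lo hi lb ub :
  (forall s, lo < s < hi -> is_derive t s (h s)) ->
  (forall s, lo < s < hi -> 0 < h s) ->
  lo < lb -> lb < ub -> ub < hi ->
  exists T, (forall y, t lb <= y <= t ub -> lb <= T y <= ub /\ t (T y) = y) /\
    (forall y, t lb < y < t ub -> is_derive T y (/ h (T y))).
Proof.
intros Dt Ph Hl Hlu Hu.
assert (Inc := increasing_derive t h lo hi Dt Ph).
assert (Dp : forall a, lb <= a <= ub -> derivable_pt_lim t a (h a)).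
{ intros a Ha; apply is_derive_Reals, Dt; lra. }
assert (Cont : forall a, lb <= a <= ub -> continuity_pt t a).
{ intros a Ha; apply derivable_continuous_pt. exists (h a). now apply Dp. }
(* [T] has to be a total function; outside the range of [t] it takes the dummy value 0. *)
assert (HT : forall y, {x | t lb <= y <= t ub -> lb <= x <= ub /\ t x = y}).
{ intros y. destruct (Rle_dec (t lb) y) as [H1 | H1]; [|exists 0; lra].
  destruct (Rle_dec y (t ub)) as [H2 | H2]; [|exists 0; lra].
  destruct (f_interv_is_interv t lb ub y Hlu (conj H1 H2) Cont) as [x Hx].
  exists x; auto. }
set (T := fun y => proj1_sig (HT y)).
assert (TP : forall y, t lb <= y <= t ub -> lb <= T y <= ub /\ t (T y) = y)
  by (intros y; exact (proj2_sig (HT y))).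
clearbody T.
assert (Inj : forall x y, lb <= x <= ub -> lb <= y <= ub -> t x = t y -> x = y).
{ intros x y Hx Hy E. destruct (Rtotal_order x y) as [H | [H | H]]; [|exact H|].
  - assert (t x < t y) by (apply Inc; lra). lra.
  - assert (t y < t x) by (apply Inc; lra). lra. }
assert (Hlt : t lb < t ub) by (apply Inc; lra).
assert (Tl : T (t lb) = lb) by (apply Inj; [apply TP; lra | lra | apply TP; lra]).
assert (Tu : T (t ub) = ub) by (apply Inj; [apply TP; lra | lra | apply TP; lra]).
exists T; split; [exact TP|].
intros y Hy.
assert (Dpt : forall a, T (t lb) <= a <= T (t ub) -> derivable_pt t a).
{ intros a Ha. exists (h a). apply Dp. lra. }
assert (Hin : T (t lb) <= T y <= T (t ub)) by (rewrite Tl, Tu; apply TP; lra).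
assert (E : derive_pt t (T y) (Dpt (T y) Hin) = h (T y)).
{ apply derive_pt_eq_0, Dp. apply TP; lra. }
apply is_derive_Reals.
replace (/ h (T y)) with (1 / derive_pt t (T y) (Dpt (T y) Hin)) by (rewrite E; unfold Rdiv; ring).
apply (derivable_pt_lim_recip_interv t T (t lb) (t ub) y Dpt); try assumption.
- apply (continuity_pt_recip_interv t T lb ub); try assumption.
  + intros u v Hu1 Huv Hv. apply Inc; lra.
  + intros x H1 H2. exact (proj2 (TP x (conj H1 H2))).
  + intros x H1 H2. exact (proj1 (TP x (conj H1 H2))).
- intros x Hx. exact (proj2 (TP x Hx)).
- rewrite E. apply Rgt_not_eq, Ph. assert (lb <= T y <= ub) by (apply TP; lra). lra.
Qed.

Lemma derive_zero_const (f : R -> R) lo hi x y :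
  (forall s, lo < s < hi -> is_derive f s 0) -> lo < x < hi -> lo < y < hi -> f x = f y.
Proof.
intros D0 Hx Hy.
destruct (Rtotal_order x y) as [H | [H | H]].
- apply (eq_is_derive f x y); [|exact H]. intros; apply D0; lra.
- now rewrite H.
- symmetry; apply (eq_is_derive f y x); [|exact H]. intros; apply D0; lra.
Qed.

(* Along the curves [t a - t b = const] the function [L] is constant; [L] increases with [a]. *)
Lemma level_sets_lt (L : R -> R -> R) (t h : R -> R) lo hi a b a' b' :
  (forall s, lo < s < hi -> is_derive t s (h s)) ->
  (forall s, lo < s < hi -> 0 < h s) ->
  (forall p q u dp dq, lo < p u < hi -> lo < q u < hi -> q u < p u ->
     is_derive p u dp -> is_derive q u dq ->
     exists F, 0 < F /\
       is_derive (fun x => L (p x) (q x)) u (F * (dp * h (p u) - dq * h (q u)))) ->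
  lo < b -> b < a -> a < hi -> lo < b' -> b' < a' -> a' < hi ->
  t a - t b < t a' - t b' -> L a b < L a' b'.
Proof.
intros Dt Ph DL Hb Hab Ha Hb' Hab' Ha' Hlt.
assert (Inc := increasing_derive t h lo hi Dt Ph).
(* A compact interval inside (lo, hi) with all four parameters in its interior, where [t] has a
   differentiable inverse. *)
set (lb := (lo + Rmin b b') / 2). set (ub := (Rmax a a' + hi) / 2).
assert (B1 := Rmin_l b b'). assert (B2 := Rmin_r b b').
assert (B3 : lo < Rmin b b') by now apply Rmin_glb_lt.
assert (A1 := Rmax_l a a'). assert (A2 := Rmax_r a a').
assert (A3 : Rmax a a' < hi) by now apply Rmax_lub_lt.
assert (Hl : lo < lb) by (unfold lb; lra). assert (Hu : ub < hi) by (unfold ub; lra).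
assert (Lb : lb < b) by (unfold lb; lra). assert (Lb' : lb < b') by (unfold lb; lra).
assert (Ua : a < ub) by (unfold ub; lra). assert (Ua' : a' < ub) by (unfold ub; lra).
clearbody lb ub.
assert (Hlu : lb < ub) by lra.
destruct (inverse_derive t h lo hi lb ub Dt Ph Hl Hlu Hu) as [T [TP DT]].
assert (Inj : forall x y, lo < x < hi -> lo < y < hi -> t x = t y -> x = y).
{ intros x y Hx Hy E. destruct (Rtotal_order x y) as [H | [H | H]]; [|exact H|].
  - assert (t x < t y) by (apply Inc; lra). lra.
  - assert (t y < t x) by (apply Inc; lra). lra. }
assert (E1 : t lb < t b) by (apply Inc; lra). assert (E2 : t b < t a) by (apply Inc; lra).
assert (E3 : t a < t ub) by (apply Inc; lra). assert (E4 : t lb < t b') by (apply Inc; lra).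
assert (E5 : t b' < t a') by (apply Inc; lra). assert (E6 : t a' < t ub) by (apply Inc; lra).
assert (TK : forall s, lb < s < ub -> T (t s) = s).
{ intros s Hs. assert (t lb < t s) by (apply Inc; lra). assert (t s < t ub) by (apply Inc; lra).
  destruct (TP (t s)) as [Q1 Q2]; [lra|]. apply Inj; [lra | lra | exact Q2]. }
set (d := t a - t b) in *.
assert (Pd : 0 < d) by (unfold d; lra).
(* The pair slides from (a, b) with t a - t b fixed until its second point is b'. Both terms of the
   variation are 1 on this path and cancel. *)
assert (Flow : L (T (t b + d)) (T (t b)) = L (T (t b' + d)) (T (t b'))).
{ apply (derive_zero_const (fun u => L (T (u + d)) (T u)) (t lb) (t ub - d)); [|unfold d; lra|lra].
  intros u Hu'.
  destruct (TP u) as [Q1 Q2]; [lra|]. destruct (TP (u + d)) as [Q3 Q4]; [lra|].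
  assert (Dq : is_derive T u (/ h (T u))) by (apply DT; lra).
  assert (Dp : is_derive (fun u => T (u + d)) u (/ h (T (u + d)))).
  { evar_last.
    - apply (is_derive_comp T (fun u => u + d)); [apply DT; lra|].
      apply derive_plus; [apply (is_derive_id u) | apply derive_const].
    - unfold scal; simpl; unfold mult; simpl. change one with 1. ring. }
  destruct (DL (fun u => T (u + d)) T u (/ h (T (u + d))) (/ h (T u))) as [F [_ HF]]; try assumption.
  - lra.
  - lra.
  - destruct (Rlt_or_le (T u) (T (u + d))) as [H0 | H0]; [exact H0|].
    destruct H0 as [H0 | H0].
    + assert (t (T (u + d)) < t (T u)) by (apply Inc; lra). lra.
    + rewrite H0 in Q4. lra.
  - evar_last; [exact HF|]. cbv beta.
    assert (0 < h (T u)) by (apply Ph; lra).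
    assert (0 < h (T (u + d))) by (apply Ph; lra). field; lra. }
rewrite (TK b), (TK b') in Flow by lra.
replace (t b + d) with (t a) in Flow by (unfold d; ring).
rewrite (TK a) in Flow by lra.
rewrite Flow.
destruct (TP (t b' + d)) as [Q1 Q2]; [lra|].
(* The pair (x, b') is the end of the slide. As d < t a' - t b', the point x lies strictly between
   b' and a', and it remains to move x to a' with b' fixed. *)
set (x := T (t b' + d)) in *.
assert (Hx1 : b' < x).
{ destruct (Rlt_or_le b' x) as [H0 | [H0 | H0]]; [exact H0| |].
  - assert (t x < t b') by (apply Inc; lra). lra.
  - rewrite H0 in Q2. lra. }
assert (Hx2 : x < a').
{ destruct (Rlt_or_le x a') as [H0 | [H0 | H0]]; [exact H0| |].
  - assert (t a' < t x) by (apply Inc; lra). lra.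
  - rewrite <- H0 in Q2. lra. }
assert (DLx : forall y, x <= y <= a' -> exists l, 0 < l /\ is_derive (fun y => L y b') y l).
{ intros y Hy.
  destruct (DL (fun y => y) (fun _ => b') y 1 0) as [F [PF HF]]; try lra.
  - apply (is_derive_id y).
  - apply derive_const.
  - assert (0 < h y) by (apply Ph; lra).
    eexists; split; [|exact HF]. apply Rmult_lt_0_compat; lra. }
destruct (MVT_cor2 (fun y => L y b') (Derive (fun y => L y b')) x a' Hx2) as [z [Ez Hz]].
{ intros y Hy. destruct (DLx y Hy) as [l [_ Dl]].
  apply is_derive_Reals. apply Derive_correct. now exists l. }
destruct (DLx z) as [l [Pl Dl]]; [lra|].
assert (EL : Derive (fun y : R => L y b') z = l) by exact (is_derive_unique _ _ _ Dl).
rewrite EL in Ez.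
assert (0 < l * (a' - x)) by (apply Rmult_lt_0_compat; lra). lra.
Qed.

(** * From germs to convex arcs *)

Lemma velocity_metric_pos g x w : on_surface g x -> surface_form g x w = 0 -> w <> zero ->
  0 < metric g w w.
Proof.
intros H1 H2 N.
assert (Z : ~ (x1 w = 0 /\ x2 w = 0 /\ x3 w = 0)).
{ intros [E1 [E2 E3]]. apply N. apply vec3_ext; assumption. }
rewrite metricE. destruct g; unfold on_surface in H1; unfold surface_form in H2;
  cbn [Gauss_curvature] in *.
- rewrite H1 in H2. assert (E3 : x3 w = 0) by lra. rewrite E3.
  destruct (Req_dec (x1 w) 0) as [E1 | E1].
  + destruct (Req_dec (x2 w) 0) as [E2 | E2]; [tauto|]. nra.
  + nra.
- destruct (Req_dec (x1 w) 0) as [E1 | E1]; [|nra].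
  destruct (Req_dec (x2 w) 0) as [E2 | E2]; [|nra].
  destruct (Req_dec (x3 w) 0) as [E3 | E3]; [tauto|]. nra.
- destruct H1 as [H1 P1].
  (* Tangent vectors of the hyperboloid are spacelike: Lagrange's identity and tangency give x3(x)^2
     <Qw,w> >= x1(w)^2 + x2(w)^2. *)
  assert (C0 : 0 <= (x1 x * x2 w - x2 x * x1 w) ^ 2) by apply pow2_ge_0.
  assert (C1 : (x1 x * x2 w - x2 x * x1 w) ^ 2 =
    (x1 x ^ 2 + x2 x ^ 2) * (x1 w ^ 2 + x2 w ^ 2) - (x1 x * x1 w + x2 x * x2 w) ^ 2) by ring.
  replace (x1 x * x1 w + x2 x * x2 w) with (x3 x * x3 w) in C1 by lra.
  replace (x1 x ^ 2 + x2 x ^ 2) with (x3 x ^ 2 - 1) in C1 by lra.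
  assert (C2 : 0 < x1 w ^ 2 + x2 w ^ 2).
  { destruct (Req_dec (x1 w) 0) as [E1 | E1]; [|nra].
    destruct (Req_dec (x2 w) 0) as [E2 | E2]; [|nra].
    destruct (Req_dec (x3 w) 0) as [E3 | E3]; [tauto|].
    exfalso. rewrite E1, E2 in H2. assert (x3 x * x3 w = 0) by lra.
    apply Rmult_integral in H. lra. }
  assert (C3 : 0 < x3 x ^ 2 * (x1 w ^ 2 + x2 w ^ 2 - x3 w ^ 2)) by lra.
  assert (0 < x3 x ^ 2) by (apply pow_lt; lra).
  assert (0 < x1 w ^ 2 + x2 w ^ 2 - x3 w ^ 2) by (apply (Rmult_lt_reg_l (x3 x ^ 2)); lra).
  lra.
Qed.

Lemma metric_lin_l g p x q y z :
  metric g (lin p x q y) z = p * metric g x z + q * metric g y z.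
Proof. rewrite !metricE; unfold lin, x1, x2, x3; cbn [fst snd]; ring. Qed.

Lemma surface_form_lin_r g p x q y z :
  surface_form g z (lin p x q y) = p * surface_form g z x + q * surface_form g z y.
Proof. unfold surface_form, lin, x1, x2, x3; cbn [fst snd]; ring. Qed.

(** Used by contraposition, to turn curvature into a nonzero determinant. The part of the covariant
    acceleration orthogonal to the velocity is a multiple of the normal by [frame_decomp], and the
    multiple is the determinant. *)
Lemma geodesic_curvature_zero g c s :
  let x := c s in let w := D c s in let z := D (D c) s in
  on_surface g x -> surface_form g x w = 0 -> 0 < metric g w w ->
  surface_form g x z = - Gauss_curvature g * metric g w w ->
  det x w z = 0 -> geodesic_curvature g c s = 0.
Proof.
intros x w z H1 H2 Hw Hz Hd.
unfold geodesic_curvature, covariant_acceleration. fold x w z.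
set (k := Gauss_curvature g * metric g z x).
replace (minus z (scal k x)) with (lin 1 z (- k) x)
  by (apply vec3_ext; unfold lin, minus, plus, opp, scal, x1, x2, x3; simpl;
      unfold prod_plus, prod_opp, prod_scal; simpl; unfold plus, opp, scal; simpl;
      unfold mult; simpl; ring).
set (acc := lin 1 z (- k) x). set (m := metric g acc w / metric g w w).
replace (minus acc (scal m w)) with (lin 1 acc (- m) w)
  by (apply vec3_ext; unfold lin, minus, plus, opp, scal, x1, x2, x3; simpl;
      unfold prod_plus, prod_opp, prod_scal; simpl; unfold plus, opp, scal; simpl;
      unfold mult; simpl; ring).
set (r := lin 1 acc (- m) w).
set (n := sqrt (metric g w w)).
assert (Pn : 0 < n) by now apply sqrt_lt_R0.
assert (n2 : n ^ 2 = metric g w w) by (apply pow2_sqrt; lra).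
assert (F : frame g x (lin (/ n) w 0 w)).
{ split; [assumption|split].
  - rewrite surface_form_lin_r, H2; ring.
  - rewrite metric_lin, <- n2. field; lra. }
assert (S : surface_form g x acc = 0).
{ unfold acc. rewrite surface_form_lin_r, (surface_form_self g x H1). unfold k.
  assert (M := metric_surface_form g z x). rewrite (surface_form_sym g z x) in M. rewrite M.
  destruct g; cbn [Gauss_curvature] in *; lra. }
assert (E : r = lin (det x (lin (/ n) w 0 w) r) (normal g x (lin (/ n) w 0 w))
  (- Gauss_curvature g * 0) x).
{ apply frame_decomp; [exact F| |].
  - unfold r. rewrite surface_form_lin_r, S, H2. ring.
  - rewrite metric_lin_l, !(metric_sym g w r). unfold r.
    rewrite metric_lin_l. unfold m. field; lra. }
assert (Z : det x (lin (/ n) w 0 w) r = 0).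
{ unfold r, acc. rewrite !det_lin_r, !det_lin_m, Hd.
  destruct (det_diag x w) as [Z1 [Z2 _]]. rewrite Z1, Z2.
  destruct (det_diag x x) as [_ [_ Z3]]. ring. }
unfold norm_Q. replace (metric g r r) with 0.
- rewrite sqrt_0. unfold Rdiv; ring.
- rewrite E, Z, metric_lin. ring.
Qed.

Lemma locally_between_inv (P : R -> Prop) s0 : locally s0 P ->
  exists d : posreal, forall s, s0 - d < s < s0 + d -> P s.
Proof.
intros [d Hd]. exists d. intros s Hs. apply Hd.
change (Rabs (s - s0) < d). apply Rabs_def1; lra.
Qed.

Lemma locally_between_inv2 (P : R * R -> Prop) x y : locally (x, y) P ->
  exists d : posreal, forall a b, x - d < a < x + d -> y - d < b < y + d -> P (a, b).
Proof.
intros [d Hd]. exists d. intros a b Ha Hb. apply Hd. split; simpl.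
- change (Rabs (a - x) < d). apply Rabs_def1; lra.
- change (Rabs (b - y) < d). apply Rabs_def1; lra.
Qed.

Lemma ex_derive_der3 f s : ex_derive f s -> der3 f s (D f s).
Proof.
intros [l Hl].
assert (H1 : filterdiff (fun u => fst (f u)) (locally s) (fun y => fst (scal y l))).
{ apply (filterdiff_comp' f fst s (fun y => scal y l) fst); [exact Hl|].
  apply filterdiff_linear, is_linear_fst. }
split; [|split]; apply Derive_correct.
- exists (x1 l).
  apply (filterdiff_comp' (fun u => fst (f u)) fst s (fun y => fst (scal y l)) fst); [exact H1|].
  apply filterdiff_linear, is_linear_fst.
- exists (x2 l).
  apply (filterdiff_comp' (fun u => fst (f u)) snd s (fun y => fst (scal y l)) snd); [exact H1|].
  apply filterdiff_linear, is_linear_snd.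
- exists (x3 l).
  apply (filterdiff_comp' f snd s (fun y => scal y l) snd); [exact Hl|].
  apply filterdiff_linear, is_linear_snd.
Qed.

Lemma continuous_coords (f : R -> vec3) s : continuous f s ->
  continuous (fun u => x1 (f u)) s /\ continuous (fun u => x2 (f u)) s /\
  continuous (fun u => x3 (f u)) s.
Proof.
intros H. 
assert (H1 : continuous (fun u => fst (f u)) s)
  by (apply (continuous_comp f fst); [exact H | apply continuous_fst]).
split; [|split].
- apply (continuous_comp (fun u => fst (f u)) fst); [exact H1 | apply continuous_fst].
- apply (continuous_comp (fun u => fst (f u)) snd); [exact H1 | apply continuous_snd].
- apply (continuous_comp f snd); [exact H | apply continuous_snd].
Qed.

Lemma der3_continuous f s d : der3 f s d ->
  continuous (fun u => x1 (f u)) s /\ continuous (fun u => x2 (f u)) s /\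
  continuous (fun u => x3 (f u)) s.
Proof.
intros [H1 [H2 H3]].
split; [|split]; apply (ex_derive_continuous (V := R_NormedModule)); eexists; eassumption.
Qed.

Lemma surface_acceleration g c s : der3 c s (D c s) -> der3 (D c) s (D (D c) s) ->
  locally s (fun u => der3 c u (D c u)) -> locally s (fun u => on_surface g (c u)) ->
  surface_form g (c s) (D (D c) s) = - Gauss_curvature g * metric g (D c s) (D c s).
Proof.
intros Dc Dw L1 L2.
assert (S := locally_singleton _ _ L2).
assert (T := velocity_tangent g c s Dc L2).
assert (E := is_derive_locally_const _ s _ 0 (der3_surface_form g _ _ _ _ _ Dc Dw)).
rewrite (surface_form_tangent g _ _ S T) in E.
enough (Gauss_curvature g * metric g (D c s) (D c s) + surface_form g (c s) (D (D c) s) = 0) by lra.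
apply E. apply locally_locally in L1; apply locally_locally in L2.
apply (filter_imp (fun u => locally u (fun u => der3 c u (D c u)) /\
  locally u (fun u => on_surface g (c u)))); [|now apply filter_and].
intros u [U1 U2]. apply velocity_tangent; [exact (locally_singleton _ _ U1) | exact U2].
Qed.

(** * Joint continuity in pairs of parameters, and the size of the arc *)

Lemma continuous_Rplus {U : UniformSpace} (f h : U -> R) x :
  continuous f x -> continuous h x -> continuous (fun u => f u + h u) x.
Proof. exact (continuous_plus (V := R_NormedModule) f h x). Qed.

Lemma continuous_Rminus {U : UniformSpace} (f h : U -> R) x :
  continuous f x -> continuous h x -> continuous (fun u => f u - h u) x.
Proof. exact (continuous_minus (V := R_NormedModule) f h x). Qed.

Lemma continuous_Rmult {U : UniformSpace} (f h : U -> R) x :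
  continuous f x -> continuous h x -> continuous (fun u => f u * h u) x.
Proof. exact (continuous_mult (K := R_AbsRing) f h x). Qed.

Definition continuous3 {U : UniformSpace} (f : U -> vec3) (x : U) : Prop :=
  continuous (fun u => x1 (f u)) x /\ continuous (fun u => x2 (f u)) x /\
  continuous (fun u => x3 (f u)) x.

Lemma continuous3_comp {U V : UniformSpace} (p : U -> V) (f : V -> vec3) x :
  continuous p x -> continuous3 f (p x) -> continuous3 (fun u => f (p u)) x.
Proof.
intros Hp [H1 [H2 H3]]; split; [|split].
- exact (continuous_comp p (fun v => x1 (f v)) x Hp H1).
- exact (continuous_comp p (fun v => x2 (f v)) x Hp H2).
- exact (continuous_comp p (fun v => x3 (f v)) x Hp H3).
Qed.

Lemma continuous3_det {U : UniformSpace} (f h k : U -> vec3) x :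
  continuous3 f x -> continuous3 h x -> continuous3 k x ->
  continuous (fun u => det (f u) (h u) (k u)) x.
Proof.
intros [F1 [F2 F3]] [H1 [H2 H3]] [K1 [K2 K3]]. unfold det, dot.
repeat apply continuous_Rplus; apply continuous_Rmult; try assumption;
  unfold cross, x1, x2, x3; cbn [fst snd]; apply continuous_Rminus;
  apply continuous_Rmult; assumption.
Qed.

Lemma continuous3_lin {U : UniformSpace} (a b : U -> R) (f h : U -> vec3) x :
  continuous a x -> continuous b x -> continuous3 f x -> continuous3 h x ->
  continuous3 (fun u => lin (a u) (f u) (b u) (h u)) x.
Proof.
intros Ha Hb [F1 [F2 F3]] [H1 [H2 H3]]. unfold lin.
split; [|split]; unfold x1, x2, x3; cbn [fst snd];
  apply continuous_Rplus; apply continuous_Rmult; assumption.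
Qed.

Lemma continuous3_ball {U : UniformSpace} (f : U -> vec3) x (r : posreal) :
  continuous3 f x -> locally x (fun u => ball (f x) r (f u)).
Proof.
intros [H1 [H2 H3]].
assert (L1 : locally x (fun u => ball (x1 (f x)) r (x1 (f u))))
  by exact (H1 _ (locally_ball (x1 (f x)) r)). assert (L2 : locally x (fun u => ball (x2 (f x)) r (x2 (f u))))
  by exact (H2 _ (locally_ball (x2 (f x)) r)).
assert (L3 : locally x (fun u => ball (x3 (f x)) r (x3 (f u))))
  by exact (H3 _ (locally_ball (x3 (f x)) r)).
apply (filter_imp (fun u => ball (x1 (f x)) r (x1 (f u)) /\
  ball (x2 (f x)) r (x2 (f u)) /\ ball (x3 (f x)) r (x3 (f u))));
  [|apply filter_and; [exact L1 | apply filter_and; [exact L2 | exact L3]]].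
intros u [B1 [B2 B3]]. exact (conj (conj B1 B2) B3).
Qed.

(** Here [k] stands for [rho c s o], which is smaller than s - o in absolute value. Treating it as a
    free variable near 0 keeps meeting points close to [c s0] although [rho] is a 0/0 quotient on
    the diagonal. *)
Lemma tangent_lin_near g c s0 (r : posreal) :
  continuous3 c s0 -> continuous3 (D c) s0 -> continuous (fun s => norm_Q g (D c s)) s0 ->
  exists d : posreal, forall k s, - d < k < d -> s0 - d < s < s0 + d ->
    ball (c s0) r
      (let m := / sqrt (1 + Gauss_curvature g * (norm_Q g (D c s) * k) ^ 2) in
       lin m (c s) (- (m * k)) (D c s)).
Proof.
intros Cc Cw Cn.
pose (m := fun p : R * R =>
  / sqrt (1 + Gauss_curvature g * (norm_Q g (D c (snd p)) * fst p) ^ 2)).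
pose (G := fun p : R * R => lin (m p) (c (snd p)) ((-1) * (m p * fst p)) (D c (snd p))).
assert (Cf : continuous (fun p : R * R => fst p) (0, s0)) by apply continuous_fst.
assert (Cs : continuous (fun p : R * R => snd p) (0, s0)) by apply continuous_snd.
assert (Cm : continuous m (0, s0)).
{ unfold m.
  apply (continuous_comp (fun p : R * R => norm_Q g (D c (snd p)) * fst p)
    (fun y => / sqrt (1 + Gauss_curvature g * y ^ 2))).
  - apply continuous_Rmult; [|exact Cf].
    exact (continuous_comp _ (fun s => norm_Q g (D c s)) (0, s0) Cs Cn).
  - cbn [fst snd]. apply (ex_derive_continuous (V := R_NormedModule)).
    rewrite Rmult_0_r. auto_derive.
    replace (1 + _) with 1 by ring. rewrite sqrt_1. repeat split; lra. }
assert (CG : continuous3 G (0, s0)).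
{ apply continuous3_lin; [exact Cm| | |].
  - apply continuous_Rmult; [apply continuous_const|]. now apply continuous_Rmult.
  - now apply (continuous3_comp (fun p : R * R => snd p) c).
  - now apply (continuous3_comp (fun p : R * R => snd p) (D c)). }
assert (G0 : G (0, s0) = c s0).
{ unfold G, m; cbn [fst snd].
  replace (1 + _) with 1 by ring. rewrite sqrt_1, Rinv_1.
  apply vec3_ext; unfold lin, x1, x2, x3; cbn [fst snd]; ring. }
assert (L := continuous3_ball G (0, s0) r CG). rewrite G0 in L.
destruct (locally_between_inv2 _ _ _ L) as [d Hd]. exists d. intros k s Hk Hsd.
specialize (Hd k s ltac:(lra) Hsd). cbv zeta.
replace (- (_ * k)) with (-1 * (m (k, s) * k)) by (unfold m; cbn [fst snd]; ring). exact Hd.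
Qed.

Lemma germ_regularity g c s0 : regular_germ g c s0 ->
  exists d : posreal, forall s, s0 - d < s < s0 + d ->
    der3 c s (D c s) /\ der3 (D c) s (D (D c) s) /\ continuous3 (D (D c)) s /\
    on_surface g (c s) /\ surface_form g (c s) (D c s) = 0 /\
    0 < metric g (D c s) (D c s) /\
    surface_form g (c s) (D (D c) s) = - Gauss_curvature g * metric g (D c s) (D c s).
Proof.
intros [HC HR].
destruct (locally_between_inv _ _ (filter_and _ _ HC HR)) as [d Hd].
exists d. 
assert (Dc : forall s, s0 - d < s < s0 + d -> der3 c s (D c s)).
{ intros s Hs. destruct (Hd s Hs) as [[H1 _] _]. now apply ex_derive_der3. }
assert (Dw : forall s, s0 - d < s < s0 + d -> der3 (D c) s (D (D c) s)).
{ intros s Hs. destruct (Hd s Hs) as [[_ [H1 _]] _]. now apply ex_derive_der3. }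
intros s Hs. destruct (Hd s Hs) as [[_ [_ H3]] [H4 H5]].
assert (L := locally_between _ _ _ Hs).
assert (L1 : locally s (fun u => der3 c u (D c u))) by exact (filter_imp _ _ Dc L).
assert (L2 : locally s (fun u => on_surface g (c u)))
  by exact (filter_imp _ _ (fun u Hu => proj1 (proj2 (Hd u Hu))) L).
assert (T : surface_form g (c s) (D c s) = 0) by (apply velocity_tangent; auto).
split; [auto|]. split; [auto|]. split; [now apply continuous_coords|].
split; [assumption|]. split; [exact T|].
split; [now apply velocity_metric_pos with (c s)|].
apply surface_acceleration; auto.
Qed.

(** [arc_convex] comes from joint continuity of the determinant at (s0, s0), where the curvature
    makes it nonzero and [e] is its sign. All smaller radii are included because the arc is shrunk
    once more in the end. *)
Lemma arc_of_germ g c s0 : regular_germ g c s0 ->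
  locally s0 (fun s => geodesic_curvature g c s <> 0) ->
  exists (e : R) (d : posreal),
    (forall d', 0 < d' -> d' <= d -> convex_arc g c e (s0 - d') (s0 + d')) /\
    (forall s, s0 - d < s < s0 + d -> continuous3 (D (D c)) s).
Proof.
intros HG Hk.
destruct (germ_regularity g c s0 HG) as [d0 Hd0].
assert (H0 : s0 - d0 < s0 < s0 + d0) by (assert (P := cond_pos d0); lra).
destruct (Hd0 s0 H0) as [Dc [Dw [Cz [S [T [Pw Tz]]]]]].
assert (Cc : continuous3 c s0) by exact (der3_continuous _ _ _ Dc).
assert (Cw : continuous3 (D c) s0) by exact (der3_continuous _ _ _ Dw).
assert (Nd : det (c s0) (D c s0) (D (D c) s0) <> 0).
{ intros E. apply (locally_singleton _ _ Hk). now apply geodesic_curvature_zero. }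
assert (Cn : continuous (fun s => norm_Q g (D c s)) s0).
{ apply (ex_derive_continuous (V := R_NormedModule)). eexists. unfold norm_Q.
  apply (is_derive_comp sqrt (fun s => metric g (D c s) (D c s))).
  - now apply is_derive_Reals, derivable_pt_lim_sqrt.
  - apply der3_metric; eassumption. }
assert (He : exists e, e ^ 2 = 1 /\ 0 < e * det (c s0) (D c s0) (D (D c) s0)).
{ destruct (Rdichotomy _ _ Nd) as [H | H].
  - exists (-1). split; [ring|lra].
  - exists 1. split; [ring|lra]. }
destruct He as [e [He Pe]].
assert (Cf : continuous (fun p : R * R => fst p) (s0, s0)) by apply continuous_fst.
assert (Cs : continuous (fun p : R * R => snd p) (s0, s0)) by apply continuous_snd.
assert (CF : continuous (fun p : R * R =>
  e * det (c (snd p)) (D c (snd p)) (D (D c) (fst p))) (s0, s0)).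
{ apply continuous_Rmult; [apply continuous_const|]. apply continuous3_det.
  - now apply (continuous3_comp (fun p : R * R => snd p) c).
  - now apply (continuous3_comp (fun p : R * R => snd p) (D c)).
  - now apply (continuous3_comp (fun p : R * R => fst p) (D (D c))). }
destruct (locally_between_inv2 _ _ _ (CF (fun y => 0 < y) (open_gt 0 _ Pe))) as [d1 Hd1].
set (n0 := norm_Q g (D c s0)) in *.
assert (Pn : 0 < n0) by now apply sqrt_lt_R0.
destruct (locally_between_inv _ _ (Cn (fun y => y < n0 + 1)
  (open_lt (n0 + 1) n0 ltac:(lra)))) as [d2 Hd2].
(* For [arc_short]: the speed is below n0 + 1 and the arc has width at most 2 / (4 (n0 + 1)), so
   their product is at most 1/2 and 1 - 1/4 is positive. *)
assert (P3 : 0 < / (4 * (n0 + 1))) by (apply Rinv_0_lt_compat; lra).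
set (d3 := mkposreal _ P3).
assert (Pd : 0 < Rmin (Rmin d0 d1) (Rmin d2 d3)).
{ repeat apply Rmin_glb_lt; apply cond_pos. }
exists e, (mkposreal _ Pd). simpl.
assert (A1 := Rmin_l (Rmin d0 d1) (Rmin d2 d3)).
assert (A2 := Rmin_r (Rmin d0 d1) (Rmin d2 d3)).
assert (A3 := Rmin_l d0 d1). assert (A4 := Rmin_r d0 d1).
assert (A5 := Rmin_l d2 d3). assert (A6 := Rmin_r d2 d3).
change (pos d3) with (/ (4 * (n0 + 1))) in *.
split.
- intros d' Pd' Hd'.
  assert (I0 : forall s, s0 - d' < s < s0 + d' -> s0 - d0 < s < s0 + d0) by (intros; lra).
  assert (I1 : forall s, s0 - d' < s < s0 + d' -> s0 - d1 < s < s0 + d1) by (intros; lra).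
  assert (I2 : forall s, s0 - d' < s < s0 + d' -> s0 - d2 < s < s0 + d2) by (intros; lra).
  constructor.
  + exact He.
  + intros s Hs. apply (Hd0 s (I0 s Hs)).
  + intros s Hs. apply (Hd0 s (I0 s Hs)).
  + intros s Hs. apply (Hd0 s (I0 s Hs)).
  + intros s Hs. apply (Hd0 s (I0 s Hs)).
  + intros a b Ha Hb. exact (Hd1 a b (I1 a Ha) (I1 b Hb)).
  + intros s Hs.
    assert (Ns : norm_Q g (D c s) < n0 + 1) by exact (Hd2 s (I2 s Hs)).
    assert (Ns0 : 0 <= norm_Q g (D c s)) by apply sqrt_pos.
    apply abs_curvature_le with (1 / 2); [|destruct g; simpl; lra].
    assert (norm_Q g (D c s) * (s0 + d' - (s0 - d')) <= (n0 + 1) * (2 * / (4 * (n0 + 1)))).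
    { apply Rmult_le_compat; lra. }
    replace ((n0 + 1) * (2 * / (4 * (n0 + 1)))) with (1 / 2) in H by (field; lra).
    assert (0 <= norm_Q g (D c s) * (s0 + d' - (s0 - d'))) by (apply Rmult_le_pos; lra).
    apply pow_incr; lra.
- intros s Hs. apply (Hd0 s ltac:(lra)).
Qed.

(** * The Poritsky parameter of an arc of a conic *)

Theorem proposition1p6 (g : geometry) (C : @matrix R 3 3)
    (C_sym : symmetric_mx C) (C_nonzero : C <> zero)
    (c : R -> vec3) (s0 : R)
    (c_regular : regular_germ g c s0)
    (c_curved : locally s0 (fun s => geodesic_curvature g c s <> 0))
    (c_in_conic : locally s0 (fun s => on_conic g C (c s))) :
  string_Poritsky g c s0.
Proof.
destruct (arc_of_germ g c s0 c_regular c_curved) as [e [d0 [HA0 Cz]]].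
destruct (locally_between_inv _ _ c_in_conic) as [d1 Hd1].
assert (H0 : s0 - d0 < s0 < s0 + d0) by (assert (P := cond_pos d0); lra).
assert (HA := HA0 d0 (cond_pos d0) (Rle_refl _)).
assert (S0 := arc_surface _ _ _ _ _ HA s0 H0).
assert (Phalf : 0 < 1 / 2) by lra. set (r := mkposreal (1 / 2) Phalf).
destruct (tangent_lin_near g c s0 r) as [d2 Hd2].
- exact (der3_continuous _ _ _ (arc_velocity _ _ _ _ _ HA s0 H0)).
- exact (der3_continuous _ _ _ (arc_acceleration _ _ _ _ _ HA s0 H0)).
- apply (ex_derive_continuous (V := R_NormedModule)).
  now apply (ex_derive_speed g c e (s0 - d0) (s0 + d0)).
(* The half is for [Hd2]: [rho c a b] is below a - b, which can be as large as the full width 2 d,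
   and must stay below [d2]. *)
- assert (Pd : 0 < Rmin d0 (Rmin d1 d2) / 2).
  { apply Rdiv_lt_0_compat; [|lra]. repeat apply Rmin_glb_lt; apply cond_pos. }
  set (d := mkposreal _ Pd).
  assert (Ed : pos d = Rmin d0 (Rmin d1 d2) / 2) by reflexivity.
  assert (A1 := Rmin_l d0 (Rmin d1 d2)). assert (A2 := Rmin_r d0 (Rmin d1 d2)).
  assert (A3 := Rmin_l d1 d2). assert (A4 := Rmin_r d1 d2).
  assert (P0 := cond_pos d0). assert (P1 := cond_pos d1). assert (P2 := cond_pos d2).
  assert (Pd' := cond_pos d).
  clear HA. assert (HA := HA0 d Pd' ltac:(lra)). clear HA0.
  clearbody d.
  set (lo := s0 - d) in *. set (hi := s0 + d) in *.
  assert (HC : forall u, lo < u < hi -> conic_form C (c u) (c u) = 0).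
  { intros u Hu. apply Hd1. unfold lo, hi in Hu. lra. }
  assert (HB : forall a b, lo < a < hi -> lo < b < hi -> b < a ->
    ball (c s0) r (tangent_meet g c a b)).
  { intros a b Ha Hb Hab.
    destruct (rho_bounds g c e lo hi a b HA Ha Hb ltac:(lra)) as [_ Hr].
    assert (Hk : 0 < rho c a b < a - b).
    { replace (rho c a b) with (rho c a b / (a - b) * (a - b)) by (field; lra). nra. }
    apply (Hd2 (rho c a b) a); unfold lo, hi in *; lra. }
  (* [f] is |<Cv,v>|^(1/2) for the unit velocity v, and [h] is the density of dt = k |<Cv,v>|^(-1/2)
     ds in the parameter of [c]. *)
  set (f := fun s => sqrt (Rabs (conic_form C (D c s) (D c s))) / norm_Q g (D c s)).
  set (h := fun s => e * det (c s) (D c s) (D (D c) s) / norm_Q g (D c s) ^ 2 / f s).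
  assert (Pf : forall s, lo < s < hi -> 0 < f s).
  { intros s Hs. apply Rdiv_lt_0_compat; [|now apply (speed_pos g c e lo hi)].
    apply sqrt_lt_R0, Rabs_pos_lt. now apply (conic_velocity_neq0 g C c e lo hi). }
  assert (Ph : forall s, lo < s < hi -> 0 < h s).
  { intros s Hs. apply Rdiv_lt_0_compat; [|now apply Pf].
    apply Rdiv_lt_0_compat; [now apply (arc_convex _ _ _ _ _ HA)|].
    apply pow_lt. now apply (speed_pos g c e lo hi). }
  assert (Ch : forall s, lo < s < hi -> continuous h s).
  { intros s Hs.
    assert (Dc := arc_velocity _ _ _ _ _ HA s Hs).
    assert (Dw := arc_acceleration _ _ _ _ _ HA s Hs).
    assert (Cn : continuous (fun s => norm_Q g (D c s)) s).
    { apply (ex_derive_continuous (V := R_NormedModule)).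
      now apply (ex_derive_speed g c e lo hi). }
    assert (Pn := speed_pos _ _ _ _ _ _ HA Hs).
    assert (Cf : continuous f s).
    { apply continuous_Rmult.
      - apply (continuous_comp (fun s => Rabs (conic_form C (D c s) (D c s))) sqrt);
          [|apply continuous_sqrt].
        apply (continuous_comp (fun s => conic_form C (D c s) (D c s)) Rabs);
          [|apply continuous_Rabs].
        apply (ex_derive_continuous (V := R_NormedModule)). eexists.
        apply der3_quadratic; eassumption.
      - apply (continuous_comp _ Rinv); [exact Cn|]. apply continuous_Rinv. lra. }
    apply continuous_Rmult.
    - apply continuous_Rmult.
      + apply continuous_Rmult; [apply continuous_const|]. apply continuous3_det.
        * exact (der3_continuous _ _ _ Dc).
        * exact (der3_continuous _ _ _ Dw).
        * apply Cz. unfold lo, hi in Hs. lra.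
      + apply (continuous_comp (fun s => norm_Q g (D c s) ^ 2) Rinv).
        * simpl. apply continuous_Rmult; [exact Cn|].
          apply continuous_Rmult; [exact Cn | apply continuous_const].
        * apply continuous_Rinv. apply pow_nonzero. lra.
    - apply (continuous_comp f Rinv); [exact Cf|]. apply continuous_Rinv.
      apply Rgt_not_eq. now apply Pf. }
  assert (H0d : lo < s0 < hi) by (unfold lo, hi; lra).
  set (t := fun s => RInt h s0 s).
  assert (Dt : forall s, lo < s < hi -> is_derive t s (h s)).
  { intros s Hs. now apply (is_derive_primitive h lo hi). }
  exists r, d. cbv zeta. fold lo hi.
  split.
  + intros a b Ha Hb Hab. exists (tangent_meet g c a b). split.
    * apply (tangent_meet_intersection g c e lo hi); try assumption; [lra | now apply HB].
    * intros X HX. symmetry.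
      apply (tangent_intersection_unique g c e lo hi (c s0)); try assumption; [lra|].
      now apply HB.
  + exists t. split.
    * intros s Hs. assert (Ds := Dt s Hs).
      split; [now exists (h s)|]. split.
      -- apply (continuous_ext_loc (T := R_UniformSpace) (U := R_UniformSpace) _ h); [|now apply Ch].
         apply (filter_imp (fun u => lo < u < hi)); [|now apply locally_between].
         intros u Hu. symmetry. now apply is_derive_unique, Dt.
      -- rewrite (is_derive_unique _ _ _ Ds). apply Rgt_not_eq. now apply Ph.
    * exists (mkposreal 1 Rlt_0_1). intros p _.
      assert (DL : forall p q u dp dq, lo < p u < hi -> lo < q u < hi -> q u < p u ->
        is_derive p u dp -> is_derive q u dq ->
        exists F, 0 < F /\ is_derive (fun x => string_fun g c (p x) (q x)) u
          (F * (dp * h (p u) - dq * h (q u)))).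
      { clear p. intros p q u dp dq Hp Hq Hqp Dp Dq.
        destruct (string_fun_derive g c e lo hi p q u dp dq HA Hp Hq Hqp Dp Dq) as [F [PF HF]].
        cbv zeta in HF.
        assert (B : f (p u) * (tau g c (p u) (q u) * scale g c (p u) (q u)) =
          f (q u) * (- tau g c (q u) (p u) * scale g c (q u) (p u)))
          by exact (conic_tangent_balance g C c e lo hi _ _ C_sym HA HC Hp Hq Hqp).
        destruct (tau_sign _ _ _ _ _ _ _ HA Hp Hq Hqp) as [T1 _].
        destruct (scale_pos g c e lo hi (p u) (q u) HA Hp Hq ltac:(lra)) as [M1 _].
        assert (F1 := Pf _ Hp). assert (F2 := Pf _ Hq).
        assert (N1 := speed_pos _ _ _ _ _ _ HA Hp). assert (N2 := speed_pos _ _ _ _ _ _ HA Hq).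
        (* By the balance [B] the two ends contribute the same factor f * S, which is absorbed into
           [F]. *)
        exists (F * (f (p u) * (tau g c (p u) (q u) * scale g c (p u) (q u)))). split.
        - apply Rmult_lt_0_compat; [exact PF|]. apply Rmult_lt_0_compat; [exact F1|].
          apply Rmult_lt_0_compat; assumption.
        - evar_last; [exact HF|]. cbv beta.
          rewrite Rmult_assoc. f_equal.
          rewrite Rmult_minus_distr_l. f_equal; [|rewrite B];
            unfold h; field; repeat split; lra. }
      assert (Level : forall a b a' b', lo < a < hi -> lo < b < hi -> b < a ->
        lo < a' < hi -> lo < b' < hi -> b' < a' ->
        string_fun g c a b = string_fun g c a' b' -> t a - t b = t a' - t b').
      { intros a b a' b' Ha Hb Hab Ha' Hb' Hab' E.
        destruct (Rtotal_order (t a - t b) (t a' - t b')) as [H | [H | H]]; [|exact H|].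
        - apply (level_sets_lt _ t h lo hi a b a' b' Dt Ph DL) in H; lra.
        - apply (level_sets_lt _ t h lo hi a' b' a b Dt Ph DL) in H; lra. }
      assert (Only : forall a b X, lo < a < hi -> lo < b < hi -> b < a ->
        tangent_intersection g c (c s0) r a b X -> string_L g c a b X = string_fun g c a b).
      { intros a b X Ha Hb Hab HX.
        rewrite (tangent_intersection_unique g c e lo hi (c s0) a b X HA Ha Hb ltac:(lra) S0
          (HB a b Ha Hb Hab) HX).
        now apply (string_L_tangent_meet g c e lo hi). }
      (* If one pair attains the value p, it fixes [c_p] and [Level] carries the constant to all
         others. If none does, any positive constant will do. *)
      destruct (classic (exists a b, lo < a < hi /\ lo < b < hi /\ b < a /\
        string_fun g c a b = p)) as [[a [b [Ha [Hb [Hab Hp]]]]] | N].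
      -- exists (t a - t b). split.
         ++ assert (t b < t a) by (apply (increasing_derive t h lo hi Dt Ph); lra). lra.
         ++ intros a' b' X Ha' Hb' Hab' HX HL. rewrite (Only a' b' X) in HL by assumption.
            apply Level; try assumption. now rewrite HL.
      -- exists 1. split; [lra|].
         intros a b X Ha Hb Hab HX HL. exfalso. apply N. exists a, b.
         rewrite (Only a b X) in HL by assumption. auto.
Qed.
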